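(* Let $p$ be a prime, $t\in\mathbb{N}$, and $b_1(X),\ldots,b_t(X)\in\mathbb{F}_p[X]$ monic, nonconstant, pairwise coprime polynomials; let $(\boldsymbol{y}_n)_{n\ge0}$ be the Halton sequence in bases $b_1(X),\ldots,b_t(X)$. Let $L\in\mathbb{F}_p((X^{-1}))$ be irrational (i.e. not in $\mathbb{F}_p(X)$) such that the degrees of the partial quotients $A_i$, $i\ge1$, in its continued fraction expansion are bounded, and let $(x_n)_{n\ge0}$ be the one-dimensional digital Kronecker sequence associated with $L$. Then there is a constant $c>0$ depending only on $p,L,b_1,\ldots,b_t,t$ such that the discrepancy of the first $N$ points of $((x_n,\boldsymbol{y}_n))_{n\ge0}$ satisfies $ND_N\le c\,N^{1/2}\log^{t+1}N$ for all $N\ge2$.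
   Context: Elements of $\mathbb{F}_p$ are identified with $\{0,\ldots,p-1\}$. For $n=n_0+n_1p+\cdots+n_rp^r$ in base $p$, $n(X)=n_0+n_1X+\cdots+n_rX^r$. For $L=\sum_{i=w}^\infty a_iX^{-i}$, $\{L\}=\sum_{i\ge\max(1,w)}a_iX^{-i}$. The digital Kronecker sequence associated with $L$: writing $\{n(X)L\}=\sum_{i\ge1}c_iX^{-i}$, $x_n=\sum_{i\ge1}c_ip^{-i}$. Van der Corput sequence in base $b(X)$ (monic, nonconstant, degree $e$): write $n(X)=\sum_{i\ge0}a_i(X)b(X)^i$ with $\deg a_i<e$, $y_n=\sum_{i\ge0}a_i(p)p^{-e(i+1)}$; the Halton sequence in bases $b_1,\ldots,b_t$ juxtaposes these coordinatewise. Every irrational $L\in\mathbb{F}_p((X^{-1}))$ has a unique infinite continued fraction expansion $L=[A_0;A_1,A_2,\ldots]$ with $A_i\in\mathbb{F}_p[X]$, $\deg A_i\ge1$ for $i\ge1$. Discrepancy: $D_N=\sup_B|A_N(B)/N-\lambda(B)|$ over axis-parallel boxes $B\subseteq[0,1)^{1+t}$, $A_N(B)=\#\{0\le n<N:(x_n,\boldsymbol y_n)\in B\}$, $\lambda$ Lebesgue measure. *)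

(* Defs.v *)
From Stdlib Require Import Reals.
From HB Require Import structures.
From mathcomp Require Import all_boot all_order all_algebra.
Set Implicit Arguments. Unset Strict Implicit. Unset Printing Implicit Defensive.
Import GRing.Theory.

Local Open Scope ring_scope.

(* [Laurent v f] represents  sum_{j >= 0} f j * X^{-(v + j)}. *)
Record laurent (p : nat) := Laurent { lval : int; lcoef : nat -> 'F_p }.

(* coefficient of X^{-k} *)
Definition lc p (L : laurent p) (k : int) : 'F_p :=
  if (lval L <= k)%R then lcoef L `|k - lval L|%N else 0.

Definition leqv p (L M : laurent p) : Prop := forall k : int, lc L k = lc M k.

Definition lmul p (L M : laurent p) : laurent p :=
  Laurent (lval L + lval M)
          (fun m => \sum_(j < m.+1) lcoef L j * lcoef M (m - j)%N).

Definition lone p : laurent p := Laurent 0 (fun j => (j == 0%N)%:R).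

(* embedding of F_p[X] : q = sum_d q_d X^d = sum_d q_d X^{-(-d)} *)
Definition lpoly p (q : {poly 'F_p}) : laurent p :=
  Laurent (- (size q)%:Z)
          (fun j => if (j <= size q)%N then q`_(size q - j) else 0).

Definition polypart p (L : laurent p) : {poly 'F_p} :=
  \poly_(d < `|- lval L|%N.+1) lc L (- d%:Z).

Definition fracpart p (L : laurent p) : laurent p :=
  Laurent 1 (fun j => lc L (j.+1)%:Z).

Definition lirrational p (L : laurent p) : Prop :=
  ~ exists q r : {poly 'F_p}, q != 0 /\ leqv (lmul (lpoly q) L) (lpoly r).

Definition cf_expansion p (L : laurent p) (A : nat -> {poly 'F_p}) : Prop :=
  exists Ls : nat -> laurent p,
    leqv (Ls 0%N) L /\
    forall i, A i = polypart (Ls i) /\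
              leqv (lmul (fracpart (Ls i)) (Ls i.+1)) (lone p).

Definition nX p (n : nat) : {poly 'F_p} :=
  \poly_(i < n.+1) (((n %/ p ^ i) %% p)%N%:R : 'F_p).

(* i-th digit c_i (i >= 1) of {n(X) L} = sum_{i>=1} c_i X^{-i} *)
Definition kron_digit p (L : laurent p) (n i : nat) : 'F_p :=
  lc (lmul (lpoly (nX p n)) L) i%:Z.

Definition poly_at_p p (a : {poly 'F_p}) : nat :=
  (\sum_(j < size a) nat_of_ord (nth (0 : 'F_p)%R a j) * p ^ j)%N.

Definition vdc_digit p (b : {poly 'F_p}) (n i : nat) : {poly 'F_p} :=
  modp (divp (nX p n) (b ^+ i)) b.

Local Close Scope ring_scope.
Local Open Scope R_scope.

Definition vdc p (b : {poly 'F_p}) (n : nat) : R :=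
  \big[Rplus/0]_(i < n.+1)
     Rdiv (INR (poly_at_p (vdc_digit b n i)))
          (pow (INR p) ((size b).-1 * i.+1)).

Definition is_kron_point p (L : laurent p) (n : nat) (x : R) : Prop :=
  infinite_sum
    (fun i => Rdiv (INR (nat_of_ord (kron_digit L n i.+1))) (pow (INR p) i.+1)) x.

Definition in_intv (a b x : R) : bool :=
  if Rle_dec a x then (if Rlt_dec x b then true else false) else false.

Definition box_count p (t : nat) (x : nat -> R) (b : 'I_t -> {poly 'F_p})
  (N : nat) (a0 b0 : R) (a bb : 'I_t -> R) : nat :=
  count (fun n => in_intv a0 b0 (x n) &&
                  [forall j : 'I_t, in_intv (a j) (bb j) (vdc (b j) n)])
        (iota 0 N).

Definition box_vol (t : nat) (a0 b0 : R) (a bb : 'I_t -> R) : R :=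
  (b0 - a0) * \big[Rmult/1]_(j < t) (bb j - a j).

Definition is_box (t : nat) (a0 b0 : R) (a bb : 'I_t -> R) : Prop :=
  0 <= a0 <= b0 /\ b0 <= 1 /\ forall j, 0 <= a j <= bb j /\ bb j <= 1.

(* Main.v *)
(** A block of indices [u p^k, (u + 1) p^k) consists of the n with n(X) = u(X) X^k + r(X), deg r < k.
    The Halton coordinates lie in a product of elementary intervals exactly when n(X) is in a
    residue class modulo B = prod_j b_j^(g_j), of degree d say.  If the partial quotients of L have
    degree at most K, then for Q <> 0 the fractional part of Q L has a nonzero digit among its first
    deg Q + K ones.  Hence, if s + 2d + K <= k, the linear map sending r to its residue modulo B and
    to the first s digits of {r L} is onto, so that all cells with s fixed digits contain equally
    many points of the class.  Taking s = k - 2d - K, the class has error O(p^(d + K)) in the block,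
    and it contains at most p^(k - d) points anyway (or one, if d > k); both are
    O(p^(k/2)) in the relevant range.  Cutting [0, N) into O(log N) blocks and a box into
    O(log^t N) elementary boxes gives N^(1/2) log^(t+1) N. *)
Require Import Defs.
From Stdlib Require Import Reals.
From HB Require Import structures.
From mathcomp Require Import all_boot all_order all_algebra.
From mathcomp Require Import Rstruct.
From mathcomp Require Import zify ring lra.
Set Implicit Arguments. Unset Strict Implicit. Unset Printing Implicit Defensive.
Import Order.TTheory GRing.Theory Num.Theory.
Local Open Scope ring_scope.

(** * Digit expansions in base [q] *)

(** Digit 0 is the most significant: [num q d s / q ^ s] truncates the expansion 0.d_0 d_1 ... in
    base q, so [num q d s] indexes a cell of length q^(-s). *)
Fixpoint num (q : nat) (d : nat -> nat) (s : nat) : nat :=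
  if s is s'.+1 then (num q d s' * q + d s')%N else 0%N.

Lemma num_lt q d s : (forall i, (i < s)%N -> (d i < q)%N) ->
  (num q d s < q ^ s)%N.
Proof.
elim: s => [|s IHs] dq //=.
have lt_num := IHs (fun i h => dq i (ltnW h)); rewrite expnSr.
apply: (@leq_trans ((num q d s).+1 * q)); last by rewrite leq_mul2r lt_num orbT.
by rewrite mulSn addnC ltn_add2r dq.
Qed.

Lemma num_div q d s : (d s < q)%N -> (num q d s.+1 %/ q = num q d s)%N.
Proof.
by move=> dq /=; rewrite divnMDl ?divn_small ?addn0 //; apply: leq_ltn_trans dq.
Qed.

Lemma num_inj q d d' s :
  (forall i, (d i < q)%N) -> (forall i, (d' i < q)%N) ->
  num q d s = num q d' s -> forall i, (i < s)%N -> d i = d' i.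
Proof.
move=> dq d'q; elim: s => [|s IHs] // E i; rewrite ltnS leq_eqVlt.
have Es : num q d s = num q d' s by rewrite -(num_div (dq s)) E num_div.
case/orP=> [/eqP->|]; last exact: IHs.
by move: E => /=; rewrite Es => /addnI.
Qed.

Lemma eq_num q d d' s : (forall i, (i < s)%N -> d i = d' i) ->
  num q d s = num q d' s.
Proof.
elim: s => //= s IHs E; rewrite E // IHs // => i /ltnW; exact: E.
Qed.

Lemma num_surj q C s : (0 < q)%N -> (C < q ^ s)%N ->
  exists2 d, forall i, (d i < q)%N & num q d s = C.
Proof.
move=> q0; elim: s C => [|s IHs] C Cq.
  by exists (fun=> 0%N) => //; case: C Cq.
have [|d dq dC] := IHs (C %/ q)%N; first by rewrite ltn_divLR // -expnSr.
exists (fun i => if i == s then (C %% q)%N else d i) => [i|/=].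
  by case: ifP; rewrite ?ltn_pmod.
rewrite eqxx (@eq_num _ _ d) ?dC -?divn_eq // => i.
by rewrite ltn_neqAle => /andP[/negPf->].
Qed.

Section NumReal.
Variables (R : realFieldType) (q : nat) (q0 : (0 < q)%N).
Implicit Type d : nat -> nat.

Lemma sum_digits d T :
  \sum_(i < T) (d i)%:R / q%:R ^+ i.+1 = (num q d T)%:R / q%:R ^+ T :> R.
Proof.
have qN0 : q%:R != 0 :> R by rewrite pnatr_eq0 -lt0n.
elim: T => [|T IHT]; first by rewrite big_ord0 mul0r.
rewrite big_ord_recr /= IHT natrD natrM exprS; field.
by rewrite qN0 expf_neq0.
Qed.

Lemma num_expand d g k : (forall i, (d i < q)%N) ->
  (num q d g * q ^ k <= num q d (g + k) < (num q d g).+1 * q ^ k)%N.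
Proof.
move=> dq; elim: k => [|k /andP[lo hi]]; first by rewrite addn0 !muln1 ltnSn leqnn.
rewrite addnS /= !expnSr !mulnA; apply/andP; split.
  by apply: leq_trans (leq_addr _ _); rewrite leq_mul2r lo orbT.
apply: (@leq_trans ((num q d (g + k)).+1 * q)).
  by rewrite mulSn addnC ltn_add2r.
by rewrite leq_mul2r hi orbT.
Qed.

(** Both bounds are non-strict, so that they survive the passage to an infinite sum, whose tail may
    consist of digits q - 1 only. *)
Lemma sum_digits_bounds d g T : (forall i, (d i < q)%N) -> (g <= T)%N ->
  (num q d g)%:R / q%:R ^+ g <= \sum_(i < T) (d i)%:R / q%:R ^+ i.+1 :> R /\
  \sum_(i < T) (d i)%:R / q%:R ^+ i.+1 <= (num q d g).+1%:R / q%:R ^+ g :> R.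
Proof.
move=> dq /subnKC<-; set k := (T - g)%N.
have qX n : 0 < q%:R ^+ n :> R by rewrite exprn_gt0 // ltr0n.
have /andP[lo hi] := num_expand g k dq.
rewrite sum_digits exprD.
have -> x : x / (q%:R ^+ g * q%:R ^+ k) = x / q%:R ^+ k / q%:R ^+ g :> R.
  by rewrite invfM mulrA mulrAC.
split; rewrite ler_pM2r ?invr_gt0 //.
  by rewrite ler_pdivlMr // -natrX -natrM ler_nat.
by rewrite ler_pdivrMr // -natrX -natrM ler_nat ltnW.
Qed.

End NumReal.

(** * Polynomials and base-[p] digits *)

Section Digits.
Variables (p : nat) (pP : prime p).
Let p1 : (1 < p)%N := prime_gt1 pP.
Let p0 : (0 < p)%N := prime_gt0 pP.
Implicit Types P B : {poly 'F_p}.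

Lemma Fp_val_lt (x : 'F_p) : (x < p)%N.
Proof. by have := ltn_ord x; rewrite {2}Fp_cast. Qed.

Lemma coef_nX n i : (nX p n)`_i = ((n %/ p ^ i) %% p)%N%:R.
Proof.
rewrite coef_poly; case: ltnP => // lt_ni.
rewrite divn_small ?mod0n // (leq_trans (ltn_expl n p1)) //.
by rewrite leq_exp2l // ltnW.
Qed.

Lemma nX_rec n c : (c < p)%N -> nX p (n * p + c) = nX p n * 'X + c%:R%:P.
Proof.
move=> cp; apply/polyP=> i; rewrite coefD coefMX coefC !coef_nX.
case: i => [|i] /=; first by rewrite divn1 modnMDl modn_small // add0r.
by rewrite addr0 expnS divnMA divnMDl // (divn_small cp) addn0.
Qed.

Lemma nX0 : nX p 0 = 0.
Proof. by apply/polyP=> i; rewrite coef_nX div0n mod0n coef0. Qed.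

Lemma nX_block u k r : (r < p ^ k)%N ->
  nX p (u * p ^ k + r) = nX p u * 'X^k + nX p r.
Proof.
elim: k r => [|k IHk] r rk.
  by case: r rk => // _; rewrite addn0 muln1 expr0 mulr1 nX0 addr0.
rewrite expnSr {1}(divn_eq r p) addnA mulnA -mulnDl nX_rec ?ltn_pmod //.
rewrite IHk ?ltn_divLR -?expnSr // {3}(divn_eq r p) nX_rec ?ltn_pmod //.
by rewrite mulrDl exprSr mulrA addrA.
Qed.

Lemma size_nX n k : (n < p ^ k)%N -> (size (nX p n) <= k)%N.
Proof.
move=> nk; apply/leq_sizeP => j kj; rewrite coef_nX divn_small ?mod0n //.
by rewrite (leq_trans nk) // leq_exp2l.
Qed.

Lemma poly_at_p_wide P T : (size P <= T)%N ->
  poly_at_p P = (\sum_(j < T) nat_of_ord (P`_j)%R * p ^ j)%N.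
Proof.
move=> PT; rewrite /poly_at_p (big_ord_widen _ (fun j => nat_of_ord (P`_j)%R * p ^ j)%N PT).
rewrite big_mkcond; apply: eq_bigr => j _; case: ltnP => // Pj.
by rewrite nth_default.
Qed.

Lemma poly_at_p_rec P (c : 'F_p) :
  poly_at_p (P * 'X + c%:P) = (poly_at_p P * p + c)%N.
Proof.
rewrite (@poly_at_p_wide _ (size P).+1); last first.
  by rewrite size_MXaddC; case: ifP.
have E0 : (P * 'X + c%:P)`_0 = c by rewrite coefD coefMX coefC add0r.
have ES i : (P * 'X + c%:P)`_i.+1 = P`_i by rewrite coefD coefMX coefC addr0.
rewrite (poly_at_p_wide (leqnn _)) big_ord_recl E0 muln1 addnC big_distrl /=.
by congr (_ + _)%N; apply: eq_bigr => i _; rewrite ES expnSr mulnA.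
Qed.

Lemma nX_poly_at_p P : nX p (poly_at_p P) = P.
Proof.
elim/poly_ind: P => [|P c IHP].
  by rewrite /poly_at_p size_poly0 big_ord0 nX0.
rewrite poly_at_p_rec nX_rec ?Fp_val_lt // IHP; congr (_ + _%:P).
by rewrite natr_Zp.
Qed.

Lemma poly_at_p_nX n : poly_at_p (nX p n) = n.
Proof.
elim/ltn_ind: n => -[|n] IHn; first by rewrite nX0 /poly_at_p size_poly0 big_ord0.
rewrite {1}(divn_eq n.+1 p) nX_rec ?ltn_pmod // poly_at_p_rec IHn ?ltn_Pdiv //.
by rewrite val_Fp_nat // modn_mod -divn_eq.
Qed.

Lemma poly_at_p_lt P k : (size P <= k)%N -> (poly_at_p P < p ^ k)%N.
Proof.
elim: k P => [|k IHk] P.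
  by rewrite leqn0 size_poly_eq0 => /eqP->; rewrite /poly_at_p size_poly0 big_ord0.
elim/poly_ind: P => [_|P c _]; first by rewrite /poly_at_p size_poly0 big_ord0 expn_gt0 p0.
move=> szP; have/IHk lt_k : (size P <= k)%N.
  by move: szP; rewrite size_MXaddC; case: ifP => // /andP[/eqP-> _]; rewrite size_poly0.
rewrite poly_at_p_rec expnSr; apply: (@leq_trans ((poly_at_p P).+1 * p)).
  by rewrite mulSn addnC ltn_add2r Fp_val_lt.
by rewrite leq_mul2r lt_k orbT.
Qed.

Lemma poly_at_p_inj P B : poly_at_p P = poly_at_p B -> P = B.
Proof. by move=> E; rewrite -[P]nX_poly_at_p E nX_poly_at_p. Qed.

End Digits.

(** * Continued fractions with bounded partial quotients *)

Section ContinuedFraction.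
Variable F : fieldType.
Implicit Types (f g : nat -> F) (Q : {poly F}).

(* If [f k] is the coefficient of [X^{-k}] in [L], this is the coefficient of [X^{-k}] in [Q L]. *)
Definition hk f Q k : F := \sum_(d < size Q) Q`_d * f (k + d)%N.

Lemma hk_wide f Q k T : (size Q <= T)%N -> hk f Q k = \sum_(d < T) Q`_d * f (k + d)%N.
Proof.
move=> QT; rewrite /hk (big_ord_widen _ (fun d => Q`_d * f (k + d)%N) QT).
rewrite big_mkcond; apply: eq_bigr => d _; case: ltnP => // Qd.
by rewrite nth_default // mul0r.
Qed.

(** Power series are treated as polynomials truncated at T, so that associativity of their product
    comes from the polynomial ring. *)
Lemma coef_trunc_mul f g T n : (n < T)%N ->
  ((\poly_(i < T) f i) * (\poly_(i < T) g i))`_n = \sum_(j < n.+1) f j * g (n - j)%N.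
Proof.
move=> nT; rewrite coefM; apply: eq_bigr => j _.
by rewrite !coef_poly (leq_ltn_trans (leq_ord j) nT) (leq_ltn_trans (leq_subr _ _) nT).
Qed.

(* Here [f] lists the coefficients of the fractional part [phi] of a complete quotient and [g] those
   of the next one, [1 / phi], shifted by its degree [a], so [f g = X^a]; [R] is the polynomial part
   of [Q phi].  The leading digits of [Q phi] vanish, so [R / phi] inherits the vanishing. *)
Lemma hk_step f g a K Q :
  (0 < a <= K)%N -> f 0%N = 0 -> g 0%N != 0 ->
  (forall n, \sum_(j < n.+1) f j * g (n - j)%N = (n == a)%:R) ->
  Q != 0 -> (forall k, (0 < k <= (size Q).-1 + K)%N -> hk f Q k = 0) ->
  exists R : {poly F}, [/\ R != 0, (size R < size Q)%N &
    forall k, (0 < k <= (size R).-1 + K)%N -> hk (fun i => g (i + a)%N) R k = 0].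
Proof.
move=> /andP[a0 aK] f0 g0 fg Q0 hQ.
have f_lt j : (j < a)%N -> f j = 0.
  elim/ltn_ind: j => j IHj ja; have := fg j.
  rewrite big_ord_recr /= subnn big1 => [|i _]; last first.
    by rewrite IHj ?mul0r // (ltn_trans _ ja).
  rewrite add0r (ltn_eqF ja) => /eqP; rewrite mulf_eq0 (negPf g0) orbF.
  by move/eqP.
set m := (size Q).-1 in hQ *.
have szQ : size Q = m.+1 by rewrite prednK // size_poly_gt0.
set T := (m + m + K + a).+1.
set Fp := \poly_(i < T) f i; set Gp := \poly_(i < T) g i.
(* Below T, index n of [U] carries the coefficient of X^(m - n) in Q phi; reversing Q turns the
   product into one of polynomials. *)
set Qr := \poly_(i < m.+1) Q`_(m - i); set U := Qr * Fp.
have UE n : (n < T)%N -> U`_n = \sum_(j < n.+1) Qr`_j * f (n - j)%N.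
  move=> nT; rewrite coefM; apply: eq_bigr => j _.
  by rewrite [Fp`__]coef_poly (leq_ltn_trans (leq_subr _ _) nT).
have UG n : (n < T)%N -> \sum_(j < n.+1) U`_j * g (n - j)%N =
    if (a <= n)%N then Qr`_(n - a) else 0.
  move=> nT; transitivity (U * Gp)`_n.
    rewrite coefM; apply: eq_bigr => j _.
    by rewrite [Gp`__]coef_poly (leq_ltn_trans (leq_subr _ _) nT).
  rewrite -mulrA coefM.
  have E (j : 'I_n.+1) : (Fp * Gp)`_(n - j) = ((n - j)%N == a)%:R.
    by rewrite coef_trunc_mul ?fg // (leq_ltn_trans (leq_subr _ _) nT).
  under eq_bigr do rewrite E.
  case: leqP => an; last first.
    rewrite big1 // => j _; rewrite (_ : _ == a = false) ?mulr0 //.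
    by apply/negbTE; rewrite neq_ltn (leq_ltn_trans (leq_subr _ _) an).
  have ltj : (n - a < n.+1)%N by rewrite ltnS leq_subr.
  rewrite (bigD1 (Ordinal ltj)) //= subKn // eqxx mulr1 big1 ?addr0 // => j.
  rewrite -val_eqE /= => ja; rewrite (_ : _ == a = false) ?mulr0 //.
  by have := ltn_ord j; move: ja; lia.
have U_lt n : (n < a)%N -> U`_n = 0.
  move=> na; rewrite UE; last by rewrite /T; lia.
  by rewrite big1 // => j _; rewrite f_lt ?mulr0 //; lia.
have U_mid n : (m < n <= m + m + K)%N -> U`_n = 0.
  move=> mn; rewrite UE; last by rewrite /T; lia.
  rewrite (bigID (fun j : 'I__ => (j <= m)%N)) /= [X in _ + X]big1 => [|j jm]; last first.
    by rewrite coef_poly ltnS (negPf jm) mul0r.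
  rewrite addr0; transitivity (hk f Q (n - m)); last by apply: hQ; lia.
  rewrite /hk szQ; apply: esym.
  rewrite (reindex_inj rev_ord_inj) /=.
  rewrite (big_ord_widen n.+1 (fun i => Q`_(m.+1 - i.+1) * f (n - m + (m.+1 - i.+1))%N)); last by lia.
  apply: eq_big => [i|i]; rewrite ?ltnS // => im.
  by rewrite coef_poly ltnS (im : (i <= m)%N) subSS; congr (_ * f _); lia.
(* The polynomial part of Q phi; its degree is at most m - a, because phi starts at X^(-a). *)
set R := \poly_(d < m.+1 - a) U`_(m - d).
have szR : (size R <= m.+1 - a)%N by apply: size_poly.
have R0 : R != 0.
  (* If [R] were zero, [U] would vanish up to index a (a <= K covers the case a > m), yet
     coefficient a of U g is the leading coefficient of Q. *)
  apply/eqP=> R0; move: (UG a ltac:(rewrite /T; lia)).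
  rewrite leqnn subnn coef_poly subn0 -[m]/(size Q).-1 -lead_coefE.
  rewrite big1 => [/esym/eqP|j _]; first by rewrite lead_coef_eq0 (negPf Q0).
  suff -> : U`_j = 0 by rewrite mul0r.
  have := ltn_ord j => ja; case: (ltnP j a) => [/U_lt//|aj].
  case: (ltnP m j) => mj; first by rewrite U_mid //; lia.
  have /polyP/(_ (m - j)%N) := R0; rewrite coef0 coef_poly subKn //.
  by rewrite ifT //; lia.
exists R; split=> //; first by rewrite szQ; lia.
move=> k /andP[k0 kK]; have am : (a <= m)%N.
  by move: R0; rewrite -size_poly_gt0; lia.
(* Coefficient m + a + k of U g is zero, since [Qr] has degree at most m. In its sum only the terms
   with a <= j <= m survive, and they form digit k of R / phi. The bound on k keeps all indices at
   most 2m + K, where [U_mid] applies. *)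
move: (UG (m + a + k)%N ltac:(rewrite /T; lia)).
rewrite ifT; last by lia.
rewrite [Qr`__]coef_poly ifF => [<-|]; last by lia.
rewrite (hk_wide _ _ szR).
rewrite (reindex_inj rev_ord_inj) /=; apply: esym.
rewrite -(big_mkord xpredT (fun j => U`_j * g (m + a + k - j)%N)).
rewrite (@big_cat_nat _ _ _ a) //=; last by lia.
rewrite big_nat_cond big1 => [|j]; last by rewrite andbT /= => /U_lt->; rewrite mul0r.
rewrite add0r (@big_cat_nat _ _ _ m.+1) //=; [|lia..].
rewrite [X in _ + X]big_nat_cond [X in _ + X]big1 => [|j]; last first.
  by rewrite andbT => jm; rewrite U_mid ?mul0r //; lia.
rewrite addr0 -{1}[a]add0n big_addn big_mkord; apply: eq_bigr => i _.
have := ltn_ord i => im; rewrite [R`__]coef_poly ifT; last by lia.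
by congr (U`_ _ * g _); lia.
Qed.

End ContinuedFraction.

(** * Laurent series and descent along the complete quotients *)

Section Laurent.
Variable p : nat.
Implicit Types L M : laurent p.

Lemma lc_lt L k : k < lval L -> lc L k = 0.
Proof. by rewrite /lc leNgt => ->. Qed.

Lemma lc_lcoef L j : lc L (lval L + j%:Z) = lcoef L j.
Proof. by rewrite /lc lerDl lez_nat leq0n [_ - _]addrC addKr absz_nat. Qed.

(** The convolution may start at any [x] up to [lval L] and have any sufficient length, since the
    extra terms vanish. This allows sums over different ranges to be compared, [lval] being only a
    lower bound for the order. *)
Lemma lc_lmul L M (x k : int) (n : nat) :
  x <= lval L -> k - x - lval M < n%:Z ->
  lc (lmul L M) k = \sum_(j < n) lc L (x + j%:Z) * lc M (k - x - j%:Z).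
Proof.
move=> xL kn; set G := fun j : nat => lc L (x + j%:Z) * lc M (k - x - j%:Z).
have G0 j : (x + j%:Z < lval L) || (k - x - j%:Z < lval M) -> G j = 0.
  by rewrite /G; case/orP=> /lc_lt->; rewrite ?mul0r ?mulr0.
rewrite /lc /=; case: leP => [vk|kv]; last first.
  by rewrite big1 // => j _; rewrite -/(G j) G0 //; lia.
set e := `|lval L - x|%N; set w := `|_|%N.
have eE : e%:Z = lval L - x by rewrite /e; lia.
have wE : w%:Z = k - lval L - lval M by rewrite /w; lia.
rewrite -(big_mkord xpredT G) (@big_cat_nat _ _ _ e) //=; last by lia.
rewrite [X in X + _]big_nat_cond [X in X + _]big1 => [|j]; last first.
  by rewrite andbT => je; rewrite G0 //; lia.
rewrite add0r (@big_cat_nat _ _ _ (w.+1 + e)) //=; [|lia..].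
rewrite [X in _ + X]big_nat_cond [X in _ + X]big1 => [|j]; last first.
  by rewrite andbT => je; rewrite G0 //; lia.
rewrite addr0 -{1}[e]add0n big_addn addnK big_mkord; apply: eq_bigr => j _.
have jw := ltn_ord j; rewrite /G -!lc_lcoef; congr (lc _ _ * lc _ _); lia.
Qed.

Lemma kron_digitE L n i :
  kron_digit L n i = hk (fun k => lc L k%:Z) (nX p n) i.
Proof.
rewrite /kron_digit /hk; set P := nX p n.
set T := ((size P).+1 + absz (i%:Z + (size P)%:Z - lval L)%R).+1%N.
rewrite (@lc_lmul _ _ (- (size P)%:Z) _ T) //; last by rewrite opprK /T; lia.
have E (j : 'I_T) : lc (lpoly P) (- (size P)%:Z + j%:Z) =
    if (j <= size P)%N then P`_(size P - j) else 0 by rewrite (lc_lcoef (lpoly P)).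
under eq_bigr do rewrite E.
rewrite -(big_mkord xpredT (fun j => (if (j <= size P)%N then P`_(size P - j) else 0)
  * lc L (i%:Z - - (size P)%:Z - j%:Z))).
rewrite (@big_cat_nat _ _ _ (size P).+1) //=; last by rewrite leqW ?leq_addr.
rewrite [X in _ + X]big_nat_cond [X in _ + X]big1 => [|j]; last first.
  by rewrite andbT => /andP[/ltn_geF-> _]; rewrite mul0r.
(* The term j = 0 vanishes: [lpoly] starts at X^(size P), one place above the leading term. *)
rewrite addr0 big_mkord big_ord_recl /= subn0 nth_default // mul0r add0r.
rewrite [RHS](reindex_inj rev_ord_inj) /=; apply: eq_bigr => j _.
have jP := ltn_ord j; rewrite /bump /= add1n jP; congr (_ * lc L _).
by rewrite opprK PoszD -subzn // addrA.
Qed.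

(** Infinite descent: [hk_step] turns a nonzero counterexample Q for the complete quotient [Ls i]
    into a nonzero one of smaller size for [Ls i.+1]. Hence the induction on the size is stated for
    all i at once. *)
Lemma hk_cf L (A : nat -> {poly 'F_p}) K :
  cf_expansion L A -> (forall i, (1 <= i)%N -> ((size (A i)).-1 <= K)%N) ->
  forall Q : {poly 'F_p},
  (forall k, (0 < k <= (size Q).-1 + K)%N -> hk (fun k => lc L k%:Z) Q k = 0) ->
  Q = 0.
Proof.
case=> Ls [L0 LsP] AK.
suff H i (Q : {poly 'F_p}) : (forall k, (0 < k <= (size Q).-1 + K)%N ->
    hk (fun k => lc (Ls i) k%:Z) Q k = 0) -> Q = 0.
  move=> Q hQ; apply: (H 0%N) => k /hQ <-; apply: eq_bigr => d _.
  by rewrite L0.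
have [s] := ubnP (size Q).
elim: s => // s IHs in i Q *; rewrite ltnS => Qs hQ.
apply/eqP/negP => /negP Q0.
set M := Ls i.+1; set a := (size (A i.+1)).-1.
have [AE _] := LsP i.+1; have [_ fgE] := LsP i.
have M_lt k : k < - a%:Z -> lc M k = 0.
  case: (ltP k (lval M)) => [/lc_lt//|vk] ka.
  have szk : (size (A i.+1) <= `|k|)%N.
    by move: ka; rewrite /a; move: (size _) => sz; lia.
  have := nth_default 0 szk; rewrite AE coef_poly ifT; last by rewrite -/M; lia.
  by rewrite (_ : - `|k|%N%:Z = k) //; lia.
pose f (k : nat) := lc (fracpart (Ls i)) k%:Z.
pose g (k : nat) := lc M (k%:Z - a%:Z).
have f0 : f 0%N = 0 by [].
have fg n : \sum_(j < n.+1) f j * g (n - j)%N = (n == a)%:R.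
  have := fgE (n%:Z - a%:Z).
  rewrite (@lc_lmul _ _ 0 _ (n.+1 + absz (n%:Z - a%:Z - lval M)%R)) //; last by rewrite -/M; lia.
  rewrite -(big_mkord xpredT (fun j => lc (fracpart (Ls i)) (0 + j%:Z) * lc M (n%:Z - a%:Z - 0 - j%:Z))).
  rewrite (@big_cat_nat _ _ _ n.+1) ?leq_addr //=.
  rewrite [X in _ + X]big_nat_cond [X in _ + X]big1 => [|j]; last first.
    by rewrite andbT => jn; rewrite (M_lt (_ - _)) ?mulr0 //; lia.
  rewrite addr0 big_mkord => E; transitivity (lc (lone p) (n%:Z - a%:Z)).
    rewrite -E; apply: eq_bigr => j _; have jn := ltn_ord j.
    by rewrite add0r subr0 /g; congr (_ * lc _ _); lia.
  rewrite /lc /= subr0; case: leP => h.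
    by congr (nat_of_bool _)%:R; lia.
  by rewrite (_ : n == a = false) //; lia.
(* The fractional part starts at X^(-1), so for a = 0 the constant coefficient of f g would be 0
   instead of 1. *)
have a0 : (0 < a)%N.
  case: posnP => // a0; have := fg 0%N; rewrite big_ord1 f0 mul0r a0 => /esym/eqP.
  by rewrite oner_eq0.
have g0 : g 0%N != 0.
  have A0 : A i.+1 != 0 by rewrite -size_poly_gt0 /a in a0 *; lia.
  move: A0; rewrite -lead_coef_eq0 lead_coefE -/a AE coef_poly /g sub0r.
  by case: ifP => // _; rewrite eqxx.
have fE k : (0 < k)%N -> f k = lc (Ls i) k%:Z.
  by case: k => // k _; apply: (lc_lcoef (fracpart (Ls i)) k).
have hfQ k : (0 < k <= (size Q).-1 + K)%N -> hk f Q k = 0.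
  move=> kK; rewrite -(hQ k kK); apply: eq_bigr => d _; congr (_ * _).
  by apply: fE; lia.
have aK : (0 < a <= K)%N by rewrite a0 AK.
have [R [R0 RQ hR]] := hk_step aK f0 g0 fg Q0 hfQ.
move/eqP: R0; apply; apply: (IHs i.+1); first exact: leq_trans RQ Qs.
move=> k kK; rewrite -(hR k kK); apply: eq_bigr => d _; congr (_ * lc _ _).
by lia.
Qed.

End Laurent.

(** * Equidistribution of digits in residue classes *)

(** The fibers of a surjective homomorphism are translates of one another. *)
Lemma card_fiber (U V : finZmodType) (f : U -> V) :
  {morph f : x y / x - y} -> (forall v, exists u, f u = v) ->
  forall v, (#|[set u | f u == v]| * #|V| = #|U|)%N.
Proof.
move=> fB fS v.
have cardE w : #|[set u | f u == v]| = #|[set u | f u == w]|.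
  have [u1 E1] := fS (w - v).
  have f0 : f 0 = 0 by rewrite -[0](subrr 0) fB subrr.
  have fD x y : f (x + y) = f x + f y.
    have fN z : f (- z) = - f z by rewrite -sub0r fB f0 sub0r.
    by rewrite -{1}[y]opprK fB fN opprK.
  rewrite -(card_imset _ (addrI u1)); apply: eq_card => u.
  rewrite [RHS]inE; apply/imsetP/idP => [[u2]|/eqP fu].
    by rewrite inE => /eqP fu2 ->; rewrite fD E1 fu2 subrK.
  exists (u - u1); last by rewrite addrC subrK.
  by rewrite inE fB fu E1 opprB addrC subrK.
transitivity (\sum_(w : V) #|[set u | f u == v]|)%N.
  by rewrite sum_nat_const mulnC.
rewrite -[RHS]cardsT -[RHS]sum1_card [RHS](partition_big f xpredT) //=.
apply: eq_bigr => w _; rewrite (cardE w) -sum1_card.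
by apply: eq_bigl => u; rewrite !inE.
Qed.

Section HankelLinear.
Variables (F : fieldType) (l : nat -> F).
Implicit Types P Q B C : {poly F}.

Lemma hk0 k : hk l 0 k = 0.
Proof. by rewrite /hk size_poly0 big_ord0. Qed.

Lemma hkD P Q k : hk l (P + Q) k = hk l P k + hk l Q k.
Proof.
rewrite (hk_wide _ _ (size_polyD P Q)).
rewrite (hk_wide l k (leq_maxl (size P) (size Q))).
rewrite (hk_wide l k (leq_maxr (size P) (size Q))) -big_split /=.
by apply: eq_bigr => d _; rewrite coefD mulrDl.
Qed.

Lemma hkZ a P k : hk l (a *: P) k = a * hk l P k.
Proof.
rewrite (hk_wide _ _ (size_scale_leq a P)) /hk big_distrr /=.
by apply: eq_bigr => d _; rewrite coefZ mulrA.
Qed.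

Lemma hkB P Q k : hk l (P - Q) k = hk l P k - hk l Q k.
Proof. by rewrite hkD -scaleN1r hkZ mulN1r. Qed.

Lemma hkMXn B n k : hk l ('X^n * B) k = hk l B (k + n).
Proof.
have szX : (size ('X^n * B)%R <= n + size B)%N.
  apply/leq_sizeP => j nj; have nj' := leq_trans (leq_addr _ _) nj.
  by rewrite coefXnM ltnNge nj' /= nth_default // -(leq_add2l n) subnKC.
rewrite (hk_wide _ _ szX) big_split_ord /= big1 => [|i _]; last first.
  by rewrite coefXnM ltn_ord mul0r.
rewrite add0r; apply: eq_bigr => i _.
by rewrite coefXnM ltnNge leq_addr /= addKn addnA.
Qed.

Lemma hkM C B k : hk l (C * B) k = \sum_(c < size C) C`_c * hk l B (k + c).
Proof.
rewrite -{1}[C]coefK poly_def mulr_suml.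
rewrite (big_morph (fun P => hk l P k) (fun P Q => hkD P Q k) (hk0 k)).
by apply: eq_bigr => c _; rewrite -scalerAl hkZ hkMXn.
Qed.

Variable K : nat.
Hypothesis hkK : forall Q,
  (forall k, (0 < k <= (size Q).-1 + K)%N -> hk l Q k = 0) -> Q = 0.

(** The map from Q to the s digits has the Hankel matrix [H]. It is onto because its transpose is
    injective: the transpose sends W of size at most s to the first m digits of W B L, and by [hkK]
    these all vanish only if W B = 0, as deg(W B) + K <= m. *)
Lemma hk_surj B d s m (v : nat -> F) : size B = d.+1 -> (s + d + K <= m)%N ->
  exists2 Q : {poly F}, (size Q <= m)%N & forall i, (i < s)%N -> hk l (Q * B) i.+1 = v i.
Proof.
move=> szB sm; pose H : 'M[F]_(m, s) := \matrix_(j, i) hk l B (i.+1 + j).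
have rfH : row_full H.
  rewrite /row_full -mxrank_tr; apply: inj_row_free => w wH.
  have hw k : (0 < k <= m)%N -> hk l (rVpoly w * B) k = 0.
    case: k => // k /= km.
    have := congr1 (fun A : 'rV_m => A 0 (Ordinal km)) wH.
    rewrite !mxE hkM (_ : \sum_(c < size (rVpoly w)) _ =
      \sum_(c < s) (rVpoly w)`_c * hk l B (k.+1 + c)) => [E|].
      rewrite -[RHS]E; apply: eq_bigr => i _; rewrite !mxE coef_rVpoly_ord /=.
      by congr (_ * hk l B _); lia.
    rewrite (big_ord_widen _ (fun c => (rVpoly w)`_c * hk l B (k.+1 + c)) (size_poly _ _)).
    by rewrite big_mkcond; apply: eq_bigr => c _; case: ltnP => // h; rewrite nth_default // mul0r.
  have B0 : B != 0 by rewrite -size_poly_eq0 szB.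
  have /eqP : rVpoly w * B = 0.
    apply: hkK => k /andP[k0 kK]; apply: hw; rewrite k0 (leq_trans kK) //.
    apply: leq_trans sm; rewrite leq_add2r.
    have := size_polyMleq (rVpoly w) B; have : (size (rVpoly w) <= s)%N by apply: size_poly.
    move: (size _) (size _) => a b'; rewrite szB; lia.
  by rewrite mulf_eq0 (negPf B0) orbF => /eqP w0; rewrite -[w]rVpolyK w0 linear0.
have /submxP[D vD] := submx_full (\row_(i < s) v i) rfH.
exists (rVpoly D); first exact: size_poly.
move=> i is_; have := congr1 (fun A : 'rV_s => A 0 (Ordinal is_)) vD.
rewrite !mxE => ->; rewrite hkM.
rewrite (big_ord_widen _ (fun c => (rVpoly D)`_c * hk l B (i.+1 + c)) (size_poly _ _)).
rewrite big_mkcond; apply: eq_bigr => c _; rewrite coef_rVpoly_ord !mxE.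
by case: ltnP => // h; rewrite -coef_rVpoly_ord nth_default // mul0r.
Qed.

End HankelLinear.

(** * Digits in a polynomial base and residue classes *)

Section BaseExpansion.
Variables (F : fieldType) (b : {poly F}) (b1 : (1 < size b)%N).
Implicit Types P R : {poly F}.
Let b0 : b != 0. Proof. by rewrite -size_poly_gt0 ltnW. Qed.

Definition bdig P i := (P %/ b ^+ i) %% b.

Lemma bdig0 P : bdig P 0 = P %% b.
Proof. by rewrite /bdig expr0 divp1. Qed.

Lemma bdigS P i : bdig P i.+1 = bdig (P %/ b) i.
Proof. by rewrite /bdig exprS divp_divl. Qed.

(** Induction by division by b: the lowest digit is the remainder, and the quotients carry the other
    digits. *)
Lemma bdig_eqP P R g :
  reflect (forall i, (i < g)%N -> bdig P i = bdig R i) (b ^+ g %| P - R).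
Proof.
elim: g P R => [|g IHg] P R; first by rewrite expr0 dvd1p; constructor.
have -> : (b ^+ g.+1 %| P - R) =
    (P %% b == R %% b) && (b ^+ g %| P %/ b - R %/ b).
  have E : P - R = (P %/ b - R %/ b) * b + (P %% b - R %% b).
    by rewrite {1}(divp_eq P b) {1}(divp_eq R b); ring.
  have [eq_mod|] := altP eqP; first by rewrite E eq_mod subrr addr0 exprSr dvdp_mul2r.
  apply: contra_neqF => /(dvdp_trans (dvdp_exp2l b (ltn0Sn g))).
  rewrite expr1 E dvdp_addr ?dvdp_mull // => /modp_eq0P.
  by rewrite -modpN -modpD modp_id modpD modpN => /eqP; rewrite subr_eq0 => /eqP.
apply: (iffP andP) => [[/eqP m0 /IHg d] [|i]|E]; first by rewrite !bdig0.
  by rewrite ltnS !bdigS => /d.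
rewrite -!bdig0 E //; split=> //; apply/IHg => i ig; rewrite -!bdigS; exact: E.
Qed.

Lemma bdig_surj (a : nat -> {poly F}) g : (forall i, (size (a i) < size b)%N) ->
  exists R, forall i, (i < g)%N -> bdig R i = a i.
Proof.
elim: g a => [|g IHg] a sza; first by exists 0.
have [|R RE] := IHg (fun i => a i.+1) _ => //.
exists (R * b + a 0%N) => -[_|i ig].
  by rewrite bdig0 modpD modp_mull add0r modp_small.
by rewrite bdigS divpD mulpK // divp_small // addr0 RE.
Qed.

End BaseExpansion.

Section Halton.
Variables (p : nat) (pP : prime p).
Implicit Types P R : {poly 'F_p}.

(** Index of the cell of length p^(-e g), e = deg b, in which the first g digits in base b place the
    van der Corput point. *)
Definition hnum (b P : {poly 'F_p}) g :=
  num (p ^ (size b).-1) (fun i => poly_at_p (bdig b P i)) g.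

Lemma poly_at_p_bdig (b : {poly 'F_p}) P i : (1 < size b)%N ->
  (poly_at_p (bdig b P i) < p ^ (size b).-1)%N.
Proof.
move=> b1; apply: poly_at_p_lt => //; rewrite -ltnS prednK ?(ltnW b1) //.
by rewrite ltn_modp -size_poly_gt0 ltnW.
Qed.

(** A cell index is a string of g digits below p^e; each digit is the value at p of a polynomial of
    degree below e, so the string fixes one residue class modulo b^g. *)
Lemma hnum_class (b : {poly 'F_p}) g C : (1 < size b)%N -> (C < (p ^ (size b).-1) ^ g)%N ->
  exists R, forall P, (hnum b P g == C) = (b ^+ g %| P - R).
Proof.
move=> b1 /(num_surj _)[|d dq <-]; first by rewrite expn_gt0 prime_gt0.
have [|R RE] := @bdig_surj _ b b1 (fun i => nX p (d i)) g.
  by move=> i; rewrite -[ltnRHS]prednK ?(ltnW b1) // ltnS size_nX.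
exists R => P; apply/eqP/bdig_eqP => // [E i ig|E].
  apply: (poly_at_p_inj pP); rewrite [in RHS]RE // poly_at_p_nX //.
  by apply: (num_inj _ _ E) ig => j //; apply: poly_at_p_bdig.
by apply: eq_num => i ig; rewrite E // RE // poly_at_p_nX.
Qed.

Lemma hnum_inj (b : {poly 'F_p}) g P R : (1 < size b)%N -> hnum b P g = hnum b R g ->
  b ^+ g %| P - R.
Proof.
move=> b1 E; apply/bdig_eqP => // i ig; apply: (poly_at_p_inj pP).
by apply: (num_inj _ _ E) ig => j; apply: poly_at_p_bdig.
Qed.

Lemma crt_poly (I : eqType) (r : seq I) (B : I -> {poly 'F_p}) (C : I -> {poly 'F_p}) :
  uniq r -> {in r &, forall i j, i != j -> coprimep (B i) (B j)} ->
  exists R, forall P,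
    (\prod_(i <- r) B i %| P - R) = all (fun i => B i %| P - C i) r.
Proof.
elim: r => [|i r IHr] /=; first by exists 0 => P; rewrite big_nil dvd1p.
case/andP=> ir ur cop; have [//||R0 R0E] := IHr.
  by move=> j k jr kr; apply: cop; rewrite inE ?jr ?kr orbT.
have cop_i : coprimep (B i) (\prod_(j <- r) B j).
  rewrite big_seq; apply: (big_ind (fun Q => coprimep (B i) Q)) => [|P Q|j jr].
  - exact: coprimep1.
  - by rewrite coprimepMr => -> ->.
  - apply: cop; rewrite ?inE ?eqxx ?jr ?orbT //.
    by apply: contraNneq ir => ->.
set M := \prod_(j <- r) B j in cop_i R0E *.
have [[u v] /= uv] := Bezout_eq1_coprimepP _ _ cop_i.
(* By Bezout u B_i + v M = 1, so this witness is C_i modulo B_i and R0 modulo M. *)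
exists (R0 * u * B i + C i * v * M) => P; rewrite big_cons -/M Gauss_dvdp // -R0E.
have E1 : R0 * u * B i + C i * v * M = C i + (R0 - C i) * u * B i.
  by rewrite -[X in _ = X + _]mulr1 -uv; ring.
have E2 : R0 * u * B i + C i * v * M = R0 + (C i - R0) * v * M.
  by rewrite -[X in _ = X + _]mulr1 -uv; ring.
congr andb; first by rewrite E1 opprD addrA dvdp_subl // dvdp_mull.
by rewrite E2 opprD addrA dvdp_subl // dvdp_mull.
Qed.

End Halton.

Section Counting.
Variables (p : nat) (pP : prime p).
Implicit Types (P B E : {poly 'F_p}).
Let p0 : (0 < p)%N := prime_gt0 pP.

(** Identifies the indices below p^k with vectors over F_p, so that solutions of linear conditions
    can be counted. *)
Definition rowX k (r : 'I_(p ^ k)) : 'rV['F_p]_k := poly_rV (nX p r).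

Lemma rVpoly_rowX k (r : 'I_(p ^ k)) : rVpoly (rowX r) = nX p r.
Proof. by rewrite poly_rV_K // size_nX. Qed.

Lemma rowX_inj k : injective (@rowX k).
Proof.
move=> r r' /(congr1 rVpoly); rewrite !rVpoly_rowX => /(congr1 (@poly_at_p p)).
by rewrite !poly_at_p_nX // => /val_inj.
Qed.

Lemma card_rowX k (A : pred 'rV['F_p]_k) :
  #|[set r : 'I_(p ^ k) | A (rowX r)]| = #|[set w | A w]|.
Proof.
have [h hK Kh] : bijective (@rowX k).
  by apply: inj_card_bij (@rowX_inj k) _; rewrite card_mx card_Fp // mul1n card_ord.
rewrite -(card_imset _ (@rowX_inj k)); apply: eq_card => w; rewrite inE.
apply/imsetP/idP => [[r]|Aw]; first by rewrite inE => Ar ->.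
by exists (h w); rewrite ?inE Kh.
Qed.

(** Within a residue class a polynomial is determined by its quotient by B, of size at most k - deg
    B. Truncated subtraction makes the bound 1 once deg B exceeds k. *)
Lemma card_class_le B E k :
  (#|[set r : 'I_(p ^ k) | (B %| nX p r - E)%R]| <= p ^ (k - (size B).-1))%N.
Proof.
set A := [set r | _]; pose f (r : 'I_(p ^ k)) : 'rV['F_p]_(k - (size B).-1) :=
  poly_rV (nX p r %/ B).
have szf (r : 'I_(p ^ k)) : (size (nX p r %/ B)%R <= k - (size B).-1)%N.
  have [->|B0] := eqVneq B 0; first by rewrite divp0 size_poly0.
  by rewrite size_divp // leq_sub2r // size_nX.
have finj : {in A &, injective f}.
  move=> r r'; rewrite !inE => Br Br' /(congr1 rVpoly).
  rewrite !poly_rV_K // => Eq; apply: (@rowX_inj k); rewrite /rowX.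
  suff Em : nX p r %% B = nX p r' %% B.
    by rewrite (divp_eq (nX p r) B) Eq Em -divp_eq.
  apply/eqP; rewrite -subr_eq0 -modpN -modpD; apply/eqP/modp_eq0P.
  by rewrite -[nX p r](subrK E) -addrA -[E - _]opprB dvdp_subl.
rewrite -(card_in_imset finj); apply: leq_trans (max_card _) _.
by rewrite card_mx card_Fp // mul1n.
Qed.

Variables (l : nat -> 'F_p) (K : nat).
Hypothesis hkK : forall Q : {poly 'F_p},
  (forall k, (0 < k <= (size Q).-1 + K)%N -> hk l Q k = 0) -> Q = 0.

(** The conditions fix the value of a linear map [f] onto a space of dimension d + s: the residue
    modulo B together with the first s digits. So the count is that of a fiber of [f]. *)
Lemma card_class_digits B E E' d k s (v : nat -> 'F_p) :
  size B = d.+1 -> (s + d + d + K <= k)%N ->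
  #|[set r : 'I_(p ^ k) | (B %| E + nX p r - E')%R &&
      [forall i : 'I_s, hk l (E + nX p r) i.+1 == v i]]| = (p ^ (k - d - s))%N.
Proof.
move=> szB sk; have B0 : B != 0 by rewrite -size_poly_eq0 szB.
pose f (w : 'rV['F_p]_k) : 'rV['F_p]_(d + s) :=
  row_mx (poly_rV (rVpoly w %% B)) (\row_i hk l (rVpoly w) i.+1).
have sz_mod P : (size (P %% B)%R <= d)%N by rewrite -ltnS -szB ltn_modp.
have eq_poly_rV (P1 P2 : {poly 'F_p}) : (size P1 <= d)%N -> (size P2 <= d)%N ->
    ((poly_rV P1 : 'rV_d) == poly_rV P2) = (P1 == P2).
  move=> s1 s2; apply/eqP/eqP => [|->//].
  by move/(congr1 rVpoly); rewrite !poly_rV_K.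
pose tgt : 'rV['F_p]_(d + s) :=
  row_mx (poly_rV ((E' - E) %% B)) (\row_(i < s) (v i - hk l E i.+1)).
pose A (w : 'rV['F_p]_k) := (B %| E + rVpoly w - E') &&
      [forall i : 'I_s, hk l (E + rVpoly w) i.+1 == v i].
transitivity #|[set w | A w]|.
  by rewrite -card_rowX; apply: eq_card => r; rewrite !inE /A rVpoly_rowX.
have -> : [set w | A w] = [set w | f w == tgt].
  apply/setP => w; rewrite !inE /A /f /tgt.
  have -> (a1 a2 : 'rV_d) (c1 c2 : 'rV_s) :
      (row_mx a1 c1 == row_mx a2 c2 :> 'rV['F_p]__) = (a1 == a2) && (c1 == c2).
    by apply/eqP/andP => [/eq_row_mx[-> ->]|[/eqP-> /eqP->]].
  congr andb.
    rewrite eq_poly_rV // -addrAC [E - E' + _]addrC -[E - E']opprB.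
    by rewrite /dvdp modpD modpN subr_eq0.
  apply/forallP/eqP => [h|/rowP h i].
    by apply/rowP => i; rewrite !mxE -(eqP (h i)) hkD [X in X - _]addrC addrK.
  by have := h i; rewrite !mxE hkD => ->; rewrite addrC subrK.
have fB : {morph f : x y / x - y}.
  move=> x y; rewrite /f opp_row_mx add_row_mx; congr row_mx.
    by rewrite [rVpoly _]linearB modpD modpN; apply: linearB.
  by apply/rowP => i; rewrite !mxE linearB hkB.
have fS w : exists r, f r = w.
  rewrite -[w]hsubmxK; move: (lsubmx w) (rsubmx w) => w1 w2.
  have sm : (s + d + K <= k - d)%N by lia.
  (* Start from the prescribed residue [w1] and correct its digits by a multiple Q B, which leaves
     the residue alone. The size bound k - d on Q keeps Q B within size k; the default 0 merely
     extends [w2] to all indices. *)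
  have [Q szQ QE] := hk_surj hkK
    (fun i => (if insub i is Some j then w2 0 j else 0) - hk l (rVpoly w1) i.+1) szB sm.
  have szr : (size (rVpoly w1 + Q * B)%R <= k)%N.
    apply: leq_trans (size_polyD _ _) _; rewrite geq_max; apply/andP; split.
      by apply: leq_trans (size_poly _ _) _; lia.
    apply: leq_trans (size_polyMleq _ _) _; rewrite szB addnS /=.
    by apply: leq_trans (leq_add szQ (leqnn d)) _; rewrite subnK; lia.
  exists (poly_rV (rVpoly w1 + Q * B)); rewrite /f poly_rV_K //; congr row_mx.
    rewrite modpD modp_mull addr0 modp_small ?rVpolyK //.
    by rewrite szB ltnS size_poly.
  apply/rowP => i; rewrite !mxE hkD QE // (insubT (fun i => i < s)%N) ?ltn_ord //= => is_.
  by rewrite addrC subrK; congr (w2 _ _); apply: val_inj.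
have := card_fiber fB fS tgt.
rewrite !card_mx !card_Fp // !mul1n => eq_card.
have pd0 : (0 < p ^ (d + s))%N by rewrite expn_gt0 p0.
apply/eqP; rewrite -(eqn_pmul2r pd0) eq_card -expnD; apply/eqP; congr (_ ^ _)%N.
lia.
Qed.

End Counting.

(** * Counting in one block *)

Section Discretization.
Variable R : archiRealFieldType.
Implicit Types (a y : R) (S c : nat).

Definition grid a S : nat := Num.truncn (a * S%:R).

Lemma grid_bounds a S : 0 <= a ->
  (grid a S)%:R <= a * S%:R < (grid a S).+1%:R.
Proof. by move=> a0; rewrite /grid truncn_itv // mulr_ge0. Qed.

Lemma le_grid a b S : a <= b -> (grid a S <= grid b S)%N.
Proof. by move=> ab; rewrite /grid le_truncn // ler_wpM2r. Qed.

Lemma grid_le a S : a <= 1 -> (grid a S <= S)%N.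
Proof. by move=> a1; rewrite -[leqRHS](natrK (R := R)) le_truncn // ler_piMl. Qed.

(** A point of cell [c] is only known to lie in the closed cell. Deciding whether it is below [a]
    from [c] alone can fail in the cell containing [a] and, for a point at the right end of its
    cell, in the cell before. *)
Definition near c a S : R := (c == grid a S)%:R + (c.+1 == grid a S)%:R.

Lemma lt_grid_approx y a S c : (0 < S)%N -> 0 <= a ->
  c%:R <= y * S%:R <= c.+1%:R ->
  `|(y < a)%R%:R - (c < grid a S)%N%:R| <= near c a S.
Proof.
move=> S0 a0 /andP[cy yc]; have /andP[ga ag] := grid_bounds S a0.
have SR : 0 < S%:R :> R by rewrite ltr0n.
rewrite /near; case: (ltngtP c (grid a S)) => [cF|Fc|->].
- have : c.+1%:R <= (grid a S)%:R :> R by rewrite ler_nat.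
  case: ltP => ya; first by rewrite subrr normr0 add0r ler0n.
  move=> cF'; have : c.+1%:R = (grid a S)%:R :> R.
    apply/eqP; rewrite eq_le cF' (le_trans ga) // (le_trans _ yc) //.
    by rewrite ler_pM2r.
  by move/eqP; rewrite eqr_nat => ->; rewrite sub0r normrN normr1 add0r.
- have : (grid a S).+1%:R <= c%:R :> R by rewrite ler_nat.
  move=> Fc'; case: ltP => ya; last by rewrite subrr normr0 add0r ler0n.
  have : y * S%:R < a * S%:R by rewrite ltr_pM2r.
  by move: ag cy Fc'; lra.
by case: (y < a); rewrite ?subr0 ?subrr ?normr1 ?normr0 ?lerDl ?addr_ge0 ?ler0n.
Qed.

Lemma itv_grid_approx y a b S c : (0 < S)%N -> 0 <= a <= b ->
  c%:R <= y * S%:R <= c.+1%:R ->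
  `|((a <= y) && (y < b))%R%:R - ((c < grid b S)%N%:R - (c < grid a S)%N%:R)|
    <= near c b S + near c a S.
Proof.
move=> S0 /andP[a0 ab] cy.
have Hb := lt_grid_approx S0 (le_trans a0 ab) cy.
have Ha := lt_grid_approx S0 a0 cy.
have -> : ((a <= y) && (y < b))%R%:R = (y < b)%R%:R - (y < a)%R%:R :> R.
  case: (ltP y a) => ya /=; last by rewrite subr0.
  by rewrite (lt_le_trans ya ab) subrr.
rewrite (_ : _ - (_ - _) = ((y < b)%R%:R - (c < grid b S)%N%:R)
  - ((y < a)%R%:R - (c < grid a S)%N%:R)); last by ring.
exact: le_trans (ler_normB _ _) (lerD Hb Ha).
Qed.

(* [S = p^s] cells, each hit by exactly [h] of the points; the indicator of [a, b) is wrong only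
   on the four cells counted by [near]. *)
Lemma cell_count_error (T : finType) (P : pred T) (x : T -> R) (c : T -> nat) S h a b :
  (0 < S)%N -> 0 <= a <= b -> b <= 1 ->
  (forall i, P i -> (c i < S)%N /\ (c i)%:R <= x i * S%:R <= (c i).+1%:R) ->
  (forall C, (C < S)%N -> #|[set i | P i && (c i == C)]| = h) ->
  `|\sum_(i | P i) ((a <= x i) && (x i < b))%R%:R - h%:R * S%:R * (b - a)| <= 6 * h%:R.
Proof.
move=> S0 /andP[a0 ab] b1 cP hP.
have cnt C : \sum_(i | P i) (c i == C)%:R = (if (C < S)%N then h else 0%N)%:R :> R.
  case: ltnP => CS; last first.
    rewrite big1 // => i /cP[ciS _]; rewrite (_ : c i == C = false) //.
    by rewrite ltn_eqF // (leq_trans ciS).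
  by rewrite -(hP C CS) -sum1_card natr_sum big_mkcond [RHS]big_mkcond;
     apply: eq_bigr => i _; rewrite inE; case: (P i); case: eqP.
have cnt_le C : \sum_(i | P i) (c i == C)%:R <= h%:R :> R.
  by rewrite cnt ler_nat; case: ifP.
have cnt_lt F : (F <= S)%N -> \sum_(i | P i) (c i < F)%N%:R = h%:R * F%:R :> R.
  elim: F => [_|F IHF FS]; first by rewrite mulr0 big1.
  rewrite -natr1 mulrDr mulr1 -IHF ?(ltnW FS) // -[h in X in _ = _ + X]/(if true then h else 0%N).
  rewrite -FS -cnt -big_split /=; apply: eq_bigr => i _.
  by rewrite ltnS leq_eqVlt -natrD; case: ltngtP.
have near_le d : \sum_(i | P i) near (c i) d S <= 2 * h%:R.
  rewrite big_split /= (_ : 2 * h%:R = h%:R + h%:R); last by ring.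
  apply: lerD => //; case: (grid d S) => [|F]; first by rewrite big1.
  by under eq_bigr do rewrite eqSS.
have grid_err d : 0 <= d -> `|h%:R * (grid d S)%:R - h%:R * S%:R * d| <= h%:R.
  move=> d0; have /andP[g1 g2] := grid_bounds S d0.
  rewrite -mulrA -mulrBr normrM ger0_norm ?ler0n // ler_piMr ?ler0n //.
  by move: g1 g2; rewrite -natr1 ler_norml mulrC; lra.
set X := \sum_(i | P i) _; pose cF d i : R := (c i < grid d S)%N%:R.
have b0 := le_trans a0 ab; have a1 := le_trans ab b1.
(* The constant 6 is made of 4 for the points near the two ends and 1 for rounding each end to the
   grid. *)
have -> : X - h%:R * S%:R * (b - a) =
    \sum_(i | P i) (((a <= x i) && (x i < b))%R%:R - (cF b i - cF a i)) +
    ((h%:R * (grid b S)%:R - h%:R * S%:R * b) - (h%:R * (grid a S)%:R - h%:R * S%:R * a)).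
  by rewrite !sumrB -/X /cF !cnt_lt ?grid_le //; ring.
have : `|\sum_(i | P i) (((a <= x i) && (x i < b))%R%:R - (cF b i - cF a i))| <= 4 * h%:R.
  apply: le_trans (ler_norm_sum _ _ _) _.
  apply: (@le_trans _ _ (\sum_(i | P i) (near (c i) b S + near (c i) a S))).
    by apply: ler_sum => i /cP[_ cx]; apply: itv_grid_approx; rewrite ?a0.
  by rewrite big_split /=; have := near_le b; have := near_le a; lra.
have := grid_err b b0; have := grid_err a a0; rewrite !ler_norml.
move=> /andP[? ?] /andP[? ?] /andP[? ?]; apply/andP; split; lra.
Qed.

End Discretization.

Section Block.
Variables (R : archiRealFieldType) (p : nat) (pP : prime p).
Variables (l : nat -> 'F_p) (K : nat).
Hypothesis hkK : forall Q : {poly 'F_p},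
  (forall k, (0 < k <= (size Q).-1 + K)%N -> hk l Q k = 0) -> Q = 0.
Variables (t : nat) (b : 'I_t -> {poly 'F_p}).
Hypothesis b_size : forall j, (1 < size (b j))%N.
Hypothesis b_coprime : forall i j, i != j -> coprimep (b i) (b j).
Variable x : nat -> R.

Definition knum (P : {poly 'F_p}) s := num p (fun i => nat_of_ord (hk l P i.+1)) s.

Hypothesis x_digits : forall n s,
  (knum (nX p n) s)%:R <= x n * (p ^ s)%:R <= (knum (nX p n) s).+1%:R.

Definition hclass (g C : 'I_t -> nat) n :=
  [forall j, hnum (b j) (nX p n) (g j) == C j].

Let p0 : (0 < p)%N := prime_gt0 pP.
Let q j := (p ^ (size (b j)).-1)%N.

(** Each coordinate prescribes a residue modulo b_j^(g_j); coprimality merges these conditions into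
    one modulo the product. *)
Lemma hclass_dvd g C : (forall j, (C j < q j ^ g j)%N) ->
  exists B P0 : {poly 'F_p}, [/\ B != 0, (p ^ (size B).-1 = \prod_j q j ^ g j)%N
    & forall n, hclass g C n = (B %| nX p n - P0)].
Proof.
move=> hC.
have [P0 P0E] := fin_all_exists (fun j => hnum_class pP (b_size j) (hC j)).
have [||P PE] := @crt_poly p _ (index_enum 'I_t) (fun j => b j ^+ g j) P0.
- exact: index_enum_uniq.
- by move=> i j _ _ ij; rewrite coprimep_expl // coprimep_expr // b_coprime.
have b0 j : b j != 0 by rewrite -size_poly_gt0 ltnW.
exists (\prod_j b j ^+ g j), P; split.
- by apply/prodf_neq0 => j _; rewrite expf_neq0.
- pose T (Q : {poly 'F_p}) m := Q != 0 /\ (p ^ (size Q).-1 = m)%N.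
  have [_ //] : T (\prod_j b j ^+ g j) (\prod_j q j ^ g j)%N.
  apply: (big_ind2 T); rewrite /T.
  + by rewrite oner_neq0 size_poly1.
  + move=> Q1 m1 Q2 m2 [Q10 <-] [Q20 <-]; rewrite mulf_neq0 //; split=> //.
    rewrite size_mul // -expnD; congr (_ ^ _)%N.
    rewrite -!size_poly_gt0 in Q10 Q20.
    by move: (size Q1) (size Q2) Q10 Q20 => s1 s2; lia.
  + move=> j _; rewrite expf_neq0 //; split=> //.
    rewrite -expnM; congr (_ ^ _)%N; elim: (g j) => [|n IHn].
      by rewrite expr0 size_poly1 muln0.
    rewrite exprS size_mul ?expf_neq0 // mulnS -IHn.
    have := b_size j; have : (0 < size (b j ^+ n)%R)%N by rewrite size_poly_gt0 expf_neq0.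
    by move: (size (b j)) (size (b j ^+ n)%R) => s1 s2; lia.
move=> n; rewrite PE; apply/forallP/allP => [h j _|h j].
  by rewrite -P0E h.
by rewrite P0E h // mem_index_enum.
Qed.

Lemma block_error g C u k (E a0 b0 : R) :
  0 <= a0 <= b0 -> b0 <= 1 -> (forall j, (C j < q j ^ g j)%N) ->
  0 <= E -> (p ^ (k + K))%:R <= E ^+ 2 ->
  `|\sum_(r < p ^ k) (hclass g C (u * p ^ k + r) &&
        ((a0 <= x (u * p ^ k + r)) && (x (u * p ^ k + r) < b0))%R)%:R
    - (p ^ k)%:R * ((b0 - a0) / (\prod_j q j ^ g j)%:R)| <= 6 * E.
Proof.
move=> ab b1 hC E0 hE; have [B [P0 [B0 <- clsE]]] := hclass_dvd hC.
set d := (size B).-1.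
have szB : size B = d.+1 by rewrite /d prednK ?size_poly_gt0.
pose P (r : 'I_(p ^ k)) := hclass g C (u * p ^ k + r).
pose X (r : 'I_(p ^ k)) := x (u * p ^ k + r).
have PE r : P r = (B %| nX p u * 'X^k + nX p r - P0) by rewrite /P clsE nX_block.
rewrite (_ : \sum_(r < p ^ k) _ = \sum_(r | P r) ((a0 <= X r) && (X r < b0))%R%:R); last first.
  by rewrite [RHS]big_mkcond; apply: eq_bigr => r _; rewrite /P /X; case: hclass.
have pR m : 0 < (p ^ m)%:R :> R by rewrite ltr0n expn_gt0 p0.
(* If 2d + K <= k, the number h = p^(d + K) of points per cell satisfies h^2 <= p^(k + K). Otherwise
   2(k - d) <= k + K, and p^(k - d) is small enough to bound the count and the expected value
   separately. Either way E suffices, whatever d is. *)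
case: (leqP (d + d + K) k) => [dk|kd].
  set s := (k - d - d - K)%N; set h := (p ^ (d + K))%N.
  have hS : (h * p ^ s * p ^ d = p ^ k)%N.
    by rewrite -!expnD; congr (_ ^ _)%N; rewrite /s; lia.
  have hE' : h%:R <= E.
    rewrite -(@ler_pXn2r _ 2) ?nnegrE ?ler0n // (le_trans _ hE) //.
    by rewrite -natrX ler_nat -expnM leq_exp2l ?prime_gt1 //; lia.
  have -> : (p ^ k)%:R * ((b0 - a0) / (p ^ d)%:R) = h%:R * (p ^ s)%:R * (b0 - a0).
    rewrite -hS natrM natrM; field; rewrite gt_eqF ?pR //.
  apply: le_trans (_ : 6 * h%:R <= _); last by rewrite ler_pM2l.
  pose c (r : 'I_(p ^ k)) := knum (nX p (u * p ^ k + r)) s.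
  apply: (cell_count_error (c := c)) => //; first by rewrite expn_gt0 p0.
    by move=> r _; split; [apply: num_lt => i _; apply: Fp_val_lt | apply: x_digits].
  move=> D Ds; have [v vp vE] := num_surj p0 Ds.
  rewrite (_ : h = (p ^ (k - d - s))%N); last by rewrite /h /s; congr (_ ^ _)%N; lia.
  rewrite -(card_class_digits pP hkK (nX p u * 'X^k) P0 (fun i => (v i)%:R) szB); last first.
    by rewrite /s; lia.
  apply: eq_card => r; rewrite !inE PE; congr andb.
  rewrite /c /knum nX_block //; apply/eqP/forallP => [cD i|h'].
    have := num_inj _ _ (etrans cD (esym vE)) => /(_ _ vp i (ltn_ord i)) <-.
      by rewrite natr_Zp.
    by move=> j; apply: Fp_val_lt.
  rewrite -vE; apply: eq_num => i is_; rewrite (eqP (h' (Ordinal is_))).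
  by rewrite val_Fp_nat // modn_small.
have hE' : (p ^ (k - d))%:R <= E.
  rewrite -(@ler_pXn2r _ 2) ?nnegrE ?ler0n // (le_trans _ hE) //.
  by rewrite -natrX ler_nat -expnM leq_exp2l ?prime_gt1 //; lia.
have cnt0 : 0 <= \sum_(r | P r) ((a0 <= X r) && (X r < b0))%R%:R :> R by apply: sumr_ge0.
have cntE : \sum_(r | P r) ((a0 <= X r) && (X r < b0))%R%:R <= E.
  apply: le_trans hE'; apply: (@le_trans _ _ (\sum_(r | P r) 1)).
    by apply: ler_sum => r _; case: (_ && _).
  rewrite sumr_const ler_nat; apply: leq_trans (card_class_le pP B (P0 - nX p u * 'X^k) k).
  apply: subset_leq_card; apply/subsetP => r Pr; have {Pr} : P r := Pr; rewrite PE inE.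
  by rewrite opprB addrA [nX p r + _]addrC.
have volE : (p ^ k)%:R * ((b0 - a0) / (p ^ d)%:R) <= E.
  rewrite mulrA ler_pdivrMr //.
  have : (p ^ k)%:R <= (p ^ (k - d))%:R * (p ^ d)%:R :> R.
    by rewrite -natrM -expnD ler_nat leq_exp2l ?prime_gt1 //; lia.
  have : (p ^ (k - d))%:R * (p ^ d)%:R <= E * (p ^ d)%:R by rewrite ler_pM2r.
  case/andP: ab => a_ge a_le.
  have : (p ^ k)%:R * (b0 - a0) <= (p ^ k)%:R by rewrite ler_piMr //; lra.
  lra.
have vol0 : 0 <= (p ^ k)%:R * ((b0 - a0) / (p ^ d)%:R).
  by case/andP: ab => a_ge a_le; rewrite mulr_ge0 // divr_ge0 ?ler0n // subr_ge0.
rewrite ler_norml; apply/andP; split; lra.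
Qed.

End Block.

(** * From elementary boxes to boxes *)

Section Sums.
Variable R : realFieldType.

Lemma sum_ord_divide (F : nat -> R) m a s :
  \sum_(r < a * m + s) F r =
    \sum_(v < a) \sum_(r < m) F (v * m + r)%N + \sum_(r < s) F (a * m + r)%N.
Proof.
rewrite big_split_ord /=; congr (_ + _).
elim: a => [|a IHa]; first by rewrite mul0n !big_ord0.
by rewrite big_ord_recr /= mulSnr big_split_ord /= IHa.
Qed.

(** N is cut along its base p digits: each of the M levels gives at most p full blocks, and the rest
    starts at a multiple of the current block length, hence the induction over all offsets [u]. *)
Lemma block_sum (p M N : nat) (f : nat -> R) E : (0 < p)%N -> 0 <= E ->
  (forall u k, (k <= M)%N -> `|\sum_(r < p ^ k) f (u * p ^ k + r)%N| <= E) ->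
  (N < p ^ M)%N -> `|\sum_(n < N) f n| <= (M * p)%:R * E.
Proof.
move=> p0 E0 hE NM.
suff H k u n : (k <= M)%N -> (n < p ^ k)%N ->
    `|\sum_(r < n) f (u * p ^ k + r)%N| <= (k * p)%:R * E.
  by have := H M 0%N N (leqnn M) NM; rewrite mul0n.
elim: k u n => [|k IHk] u n kM nk.
  by case: n nk => // _; rewrite big_ord0 normr0 mul0n mul0r.
have pk0 : (0 < p ^ k)%N by rewrite expn_gt0 p0.
rewrite (divn_eq n (p ^ k)); set a := (n %/ _)%N.
rewrite (sum_ord_divide (fun r => f (u * p ^ k.+1 + r)%N)).
have blockE v r : (u * p ^ k.+1 + (v * p ^ k + r) = (u * p + v) * p ^ k + r)%N.
  by rewrite expnS addnA mulnA -mulnDl.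
apply: le_trans (ler_normD _ _) _; rewrite mulSn natrD mulrDl.
apply: lerD; last first.
  by under eq_bigr do rewrite blockE; apply: IHk; rewrite ?ltn_pmod // ltnW.
apply: le_trans (ler_norm_sum _ _ _) _.
have ap : (a <= p)%N by rewrite ltnW // ltn_divLR // -expnS.
apply: (@le_trans _ _ (\sum_(v < a) E)).
  by apply: ler_sum => v _; under eq_bigr do rewrite blockE; apply: hE; apply: ltnW.
by rewrite sumr_const card_ord -[E *+ a]mulr_natl ler_wpM2r // ler_nat.
Qed.

(** The factors are exchanged one at a time. *)
Lemma prod_dist (I : Type) (r : seq I) (f g : I -> R) :
  (forall i, `|f i| <= 1) -> (forall i, `|g i| <= 1) ->
  `|\prod_(i <- r) f i - \prod_(i <- r) g i| <= \sum_(i <- r) `|f i - g i|.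
Proof.
move=> f1 g1; elim: r => [|i r IHr]; first by rewrite !big_nil subrr normr0.
rewrite !big_cons; set P := \prod_(_ <- _) f _ in IHr *; set Q := \prod_(_ <- _) g _ in IHr *.
have -> : f i * P - g i * Q = (f i - g i) * P + g i * (P - Q) by ring.
apply: le_trans (ler_normD _ _) _; rewrite !normrM; apply: lerD.
  rewrite ler_piMr // /P; elim/big_ind: _ => [|x y x1 y1|//]; rewrite ?normr1 //.
  by rewrite normrM mulr_ile1.
by apply: le_trans IHr; rewrite ler_piMl.
Qed.

Lemma sum_indicator_range (u F c Q : nat) : (F <= u + Q)%N ->
  \sum_(s < Q) (u + s < F)%N%:R * (c == u + s)%N%:R = ((u <= c) && (c < F))%N%:R :> R.
Proof.
move=> FQ; case: (leqP u c) => uc /=; last first.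
  by rewrite big1 // => s _; rewrite (_ : c == _ = false) ?mulr0 //; lia.
case: (ltnP (c - u) Q) => cQ; last first.
  rewrite (_ : (c < F)%N = false); last by lia.
  rewrite big1 // => s _; have ? := ltn_ord s.
  by rewrite (_ : c == _ = false) ?mulr0 //; lia.
rewrite (bigD1 (Ordinal cQ)) //= subnKC // eqxx mulr1 big1 ?addr0 // => s.
rewrite -val_eqE /= => ns; rewrite (_ : c == _ = false) ?mulr0 //; lia.
Qed.

Lemma sum_range (u F Q : nat) : (u <= F)%N -> (F <= u + Q)%N ->
  \sum_(s < Q) (u + s < F)%N%:R = F%:R - u%:R :> R.
Proof.
move=> uF FQ; rewrite -natrB //.
have -> : Q = ((F - u) + (Q - (F - u)))%N by lia.
rewrite big_split_ord /= [X in _ + X]big1 => [|i _]; last first.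
  by rewrite (_ : (_ < F)%N = false) //; lia.
rewrite addr0 -[RHS]mulr_natl mulr1 -[in RHS](card_ord (F - u)) -sumr_const.
by apply: eq_bigr => i _; rewrite (_ : (_ < F)%N) //; have := ltn_ord i; lia.
Qed.

End Sums.

Section GridExpansion.
Variables (R : archiRealFieldType) (q Q : nat).
Hypotheses (q0 : (0 < q)%N) (qQ : (q <= Q)%N).
Variables (a : R) (a01 : 0 <= a <= 1).
Let a0 : 0 <= a. Proof. by case/andP: a01. Qed.

Let F g := grid a (q ^ g).

(* The children at level [g] of the last level-[(g - 1)] cell before [a]. *)
Definition base_cell g : nat := if g is g'.+1 then (q * F g')%N else 0%N.

Lemma base_cell_le g : (base_cell g <= F g)%N.
Proof.
case: g => // g /=; have /andP[h1 _] := grid_bounds (q ^ g) a0.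
rewrite /F /grid truncn_ge_nat ?mulr_ge0 // expnS !natrM mulrCA.
by rewrite ler_wpM2l.
Qed.

Lemma grid_le_base_cell g : (F g <= base_cell g + Q)%N.
Proof.
apply: (@leq_trans (base_cell g + q)); last by rewrite leq_add2l.
case: g => [|g] /=.
  by rewrite add0n (leq_trans _ q0) // grid_le //; case/andP: a01.
have /andP[_ h1] := grid_bounds (q ^ g) a0.
rewrite -mulnSr ltnW // -(ltr_nat R) natrM.
have /andP[h2 _] := grid_bounds (q ^ g.+1) a0.
apply: (le_lt_trans h2); rewrite expnS natrM mulrCA ltr_pM2l //.
by rewrite ltr0n.
Qed.

(* [c g < F g] holds at level [g] but not at level [g - 1] exactly when [c g] is one of the at most
   [Q] cells starting at [base_cell g]. *)
Lemma grid_expansion (c : nat -> nat) G :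
  c 0%N = 0%N -> (forall g, (c g.+1 %/ q)%N = c g) ->
  (c G < F G)%N%:R = \sum_(g < G.+1) \sum_(s < Q)
    (base_cell g + s < F g)%N%:R * (c g == base_cell g + s)%N%:R :> R.
Proof.
move=> c0 cS; elim: G => [|G IHG].
  by rewrite big_ord1 sum_indicator_range ?grid_le_base_cell //= c0.
rewrite big_ord_recr /= -IHG sum_indicator_range; last exact: grid_le_base_cell G.+1.
have -> : (c G < F G)%N = (c G.+1 < q * F G)%N by rewrite -cS ltn_divLR // mulnC.
have := base_cell_le G.+1; rewrite /= -natrD => h.
by congr _%:R; case: ltnP; case: ltnP => //=; lia.
Qed.

(** The telescoping of [grid_expansion] with each cell replaced by its length, so that count and
    volume are expanded with the same weights. *)
Lemma grid_volume_expansion G :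
  (F G)%:R / (q ^ G)%:R = \sum_(g < G.+1) \sum_(s < Q)
    (base_cell g + s < F g)%N%:R / (q ^ g)%:R :> R.
Proof.
have E g : \sum_(s < Q) (base_cell g + s < F g)%N%:R / (q ^ g)%:R =
    ((F g)%:R - (base_cell g)%:R) / (q ^ g)%:R :> R.
  by rewrite -mulr_suml sum_range ?base_cell_le ?grid_le_base_cell.
elim: G => [|G IHG]; first by rewrite big_ord1 E subr0.
rewrite big_ord_recr /= -IHG E /= expnS !natrM; field.
by rewrite natrX expf_neq0 ?pnatr_eq0 -?lt0n.
Qed.

Lemma grid_ratio G : `|a - (F G)%:R / (q ^ G)%:R| <= 1 / (q ^ G)%:R.
Proof.
have S0 : 0 < (q ^ G)%:R :> R by rewrite ltr0n expn_gt0 q0.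
have /andP[h1 h2] := grid_bounds (q ^ G) a0.
rewrite -{1}[a](mulfK (lt0r_neq0 S0)) -mulrBl normrM (gtr0_norm (_ : 0 < _^-1)) ?invr_gt0 //.
rewrite ler_pM2r ?invr_gt0 // ger0_norm ?subr_ge0 //.
by move: h2; rewrite -natr1 -/(F G); lra.
Qed.

End GridExpansion.

(** * Discrepancy of boxes from the error on elementary cells *)

Section BoxDiscrepancy.
Variables (R : archiRealFieldType) (t : nat) (q : 'I_t -> nat) (Q : nat).
Hypotheses (q0 : forall j, (0 < q j)%N) (qQ : forall j, (q j <= Q)%N).
Variables (c : 'I_t -> nat -> nat -> nat) (y : 'I_t -> nat -> R) (xi : nat -> R).
Variables (N G : nat) (V E : R) (a b : 'I_t -> R).
Hypothesis c0 : forall j n, c j 0 n = 0%N.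
Hypothesis cS : forall j g n, (c j g.+1 n %/ q j)%N = c j g n.
Hypothesis cy : forall j n,
  (c j G n)%:R <= y j n * (q j ^ G)%:R <= (c j G n).+1%:R.
Hypothesis xi01 : forall n, 0 <= xi n <= 1.
Hypothesis c_sep : forall j C, \sum_(n < N) (c j G n == C)%:R <= 1 :> R.
Hypothesis NG : forall j, (N <= q j ^ G)%N.
Hypothesis VN : 0 <= V <= N%:R.
Hypothesis ab : forall j, 0 <= a j <= b j /\ b j <= 1.
Hypothesis cell_bound : forall g C : 'I_t -> nat,
  (forall j, (C j < q j ^ g j)%N) ->
  `|\sum_(n < N) xi n * [forall j, c j (g j) n == C j]%:R
     - V / (\prod_j q j ^ g j)%:R| <= E.

Let inbox n := [forall j, (a j <= y j n) && (y j n < b j)].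
Let F j (d : bool) g := grid (if d then b j else a j) (q j ^ g).
(** An index consists of an end of the interval ([true] for the upper one), a level and an offset.
    In [weight] the lower end gets the sign -1, and offsets beyond the grid point of the end get
    weight 0. *)
Let cell j (i : bool * ('I_G.+1 * 'I_Q)) :=
  (base_cell (q j) (if i.1 then b j else a j) i.2.1 + i.2.2)%N.
Let weight j (i : bool * ('I_G.+1 * 'I_Q)) : R :=
  (-1) ^+ (~~ i.1) * (cell j i < F j i.1 i.2.1)%N%:R.

Let end01 j (d : bool) : 0 <= (if d then b j else a j) <= 1.
Proof. by have [/andP[h1 h2] h3] := ab j; case: d; apply/andP; split; lra. Qed.

(** Indicator of the interval whose ends are rounded down to the grid of level G, read off the cell
    of the point. *)
Let gj j n : R := (c j G n < F j true G)%N%:R - (c j G n < F j false G)%N%:R.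
Let vol j : R := ((F j true G)%:R - (F j false G)%:R) / (q j ^ G)%:R.

Let sum_index (f : bool * ('I_G.+1 * 'I_Q) -> R) :
  \sum_i f i = \sum_(g < G.+1) \sum_(s < Q) f (true, (g, s)) +
               \sum_(g < G.+1) \sum_(s < Q) f (false, (g, s)).
Proof.
rewrite -(big_bool _ (fun d => \sum_(g < G.+1) \sum_(s < Q) f (d, (g, s)))).
under [RHS]eq_bigr do rewrite pair_bigA.
by rewrite pair_bigA; apply: eq_bigr => -[d [g s]].
Qed.

Let gjE j n : gj j n = \sum_i weight j i * (c j i.2.1 n == cell j i)%:R.
Proof.
rewrite sum_index /weight /cell /=.
have ex d := grid_expansion (q0 j) (qQ j) (end01 j d) G (c0 j n) (cS j ^~ n).
rewrite /gj /F (ex true) (ex false) /= -[X in _ = _ + X]opprK; congr (_ - _).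
  by apply: eq_bigr => g _; apply: eq_bigr => s _; rewrite expr0 mul1r.
rewrite -sumrN; apply: eq_bigr => g _; rewrite -sumrN; apply: eq_bigr => s _.
by rewrite expr1 mulN1r mulNr opprK.
Qed.

Let volE j : vol j = \sum_i weight j i / (q j ^ i.2.1)%:R.
Proof.
rewrite sum_index /weight /cell /=.
have ex d := grid_volume_expansion (q0 j) (qQ j) (end01 j d) G.
rewrite /vol /F mulrBl (ex true) (ex false) /= -[X in _ = _ + X]opprK; congr (_ - _).
  by apply: eq_bigr => g _; apply: eq_bigr => s _; rewrite expr0 mul1r.
rewrite -sumrN; apply: eq_bigr => g _; rewrite -sumrN; apply: eq_bigr => s _.
by rewrite expr1 mulN1r mulNr opprK.
Qed.

Let weight_le1 j i : `|weight j i| <= 1.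
Proof. by rewrite normrM normrX normrN1 expr1n mul1r; case: (_ < _)%N; rewrite ?normr1 ?normr0. Qed.

Let E0 : 0 <= E.
Proof.
have h j : (0 < q j ^ 0)%N by [].
exact: le_trans (normr_ge0 _) (cell_bound (g := fun=> 0%N) (C := fun=> 0%N) h).
Qed.

(** Multiplying out the sums over the coordinates gives one signed elementary box for each [phi].
    There are (2 (G + 1) Q)^t of them, each with error at most E. *)
Let expanded_bound :
  `|\sum_(n < N) xi n * \prod_j gj j n - V * \prod_j vol j|
    <= (2 * (G.+1 * Q))%:R ^+ t * E.
Proof.
have -> : \prod_j vol j = \sum_(phi : {ffun 'I_t -> bool * ('I_G.+1 * 'I_Q)})
    (\prod_j weight j (phi j)) / (\prod_j q j ^ (phi j).2.1)%:R.
  under eq_bigr do rewrite volE.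
  rewrite bigA_distr_bigA; apply: eq_bigr => phi _.
  by rewrite big_split /= natr_prod prodfV.
have -> : \sum_(n < N) xi n * \prod_j gj j n =
    \sum_(phi : {ffun 'I_t -> bool * ('I_G.+1 * 'I_Q)}) (\prod_j weight j (phi j)) *
      \sum_(n < N) xi n * [forall j, c j (phi j).2.1 n == cell j (phi j)]%:R.
  under [RHS]eq_bigr do rewrite mulr_sumr.
  rewrite exchange_big; apply: eq_bigr => n _ /=.
  under eq_bigr do rewrite gjE.
  rewrite bigA_distr_bigA mulr_sumr; apply: eq_bigr => phi _ /=.
  rewrite big_split /= mulrCA; congr (_ * (_ * _)).
  case: forallP => [h|]; first by rewrite big1 // => j _; rewrite h.
  move/forallP; rewrite negb_forall => /existsP[j /negPf nj].
  by rewrite (bigD1 j) //= nj mul0r.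
rewrite mulr_sumr -sumrB; apply: le_trans (ler_norm_sum _ _ _) _.
have -> : (2 * (G.+1 * Q))%:R ^+ t * E =
    \sum_(phi : {ffun 'I_t -> bool * ('I_G.+1 * 'I_Q)}) E.
  by rewrite sumr_const card_ffun !card_prod card_bool !card_ord -natrX mulr_natl.
apply: ler_sum => phi _; rewrite mulrCA -mulrBr normrM.
(* [cell_bound] needs cells inside the unit cube; a [phi] whose cell passes the rounded end in some
   coordinate has weight zero. *)
case: (boolP [forall j, (cell j (phi j) < F j (phi j).1 (phi j).2.1)%N]) => [/forallP h|].
  apply: (@le_trans _ _ (1 * E)); last by rewrite mul1r.
  apply: ler_pM => //; last first.
    apply: cell_bound => j; apply: leq_trans (h j) _; apply: grid_le.
    by case/andP: (end01 j (phi j).1).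
  by elim/big_ind: _ => [|u v u1 v1|j _]; rewrite ?normr1 ?weight_le1 // normrM mulr_ile1.
rewrite negb_forall => /existsP[j /negPf nj].
by rewrite (bigD1 j) //= /weight nj mulr0 mul0r normr0 mul0r.
Qed.

Let gj_approx j n : `|((a j <= y j n) && (y j n < b j))%R%:R - gj j n| <=
  near (c j G n) (b j) (q j ^ G) + near (c j G n) (a j) (q j ^ G).
Proof.
have [h _] := ab j; have S0 : (0 < q j ^ G)%N by rewrite expn_gt0 q0.
exact: itv_grid_approx S0 h (cy j n).
Qed.

(** Each of the two cells near [d] holds at most one of the N points, by [c_sep]. *)
Let near_sum j (d : R) : \sum_(n < N) near (c j G n) d (q j ^ G) <= 2.
Proof.
rewrite big_split /= (_ : 2 = 1 + 1) //; apply: lerD => //.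
case: (grid d _) => [|f]; first by rewrite big1.
by under eq_bigr do rewrite eqSS.
Qed.

Let F_mono j : (F j false G <= F j true G)%N.
Proof. by have [/andP[_ h] _] := ab j; apply: le_grid. Qed.

Let gj_le1 j n : `|gj j n| <= 1.
Proof.
rewrite /gj; have := F_mono j; case: ltnP => h1; case: ltnP => h2 //=;
  rewrite ?subrr ?subr0 ?normr0 ?normr1 //; lia.
Qed.

Let qG_gt0 j : 0 < (q j ^ G)%:R :> R. Proof. by rewrite ltr0n expn_gt0 q0. Qed.

Let vol_le1 j : `|vol j| <= 1.
Proof.
rewrite /vol -natrB // normrM normr_nat gtr0_norm ?invr_gt0 //.
rewrite ler_pdivrMr // mul1r ler_nat (leq_trans (leq_subr _ _)) // grid_le //.
by case: (ab j).
Qed.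

(** Rounding moves each end by at most q_j^(-G), and V <= N <= q_j^G. *)
Let vol_approx j : `|V| * `|b j - a j - vol j| <= 2.
Proof.
have h d := grid_ratio (q0 j) (end01 j d) G.
have -> : b j - a j - vol j = (b j - (F j true G)%:R / (q j ^ G)%:R)
   - (a j - (F j false G)%:R / (q j ^ G)%:R) by rewrite /vol mulrBl; ring.
have hV : `|V| <= (q j ^ G)%:R.
  case/andP: VN => V0 V1; rewrite ger0_norm // (le_trans V1) // ler_nat.
  exact: NG.
have : `|V| * `|(b j - (F j true G)%:R / (q j ^ G)%:R)
   - (a j - (F j false G)%:R / (q j ^ G)%:R)| <= (q j ^ G)%:R * (1 / (q j ^ G)%:R + 1 / (q j ^ G)%:R).
  apply: ler_pM => //; apply: le_trans (ler_normB _ _) (lerD _ _).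
    exact: (h true).
  exact: (h false).
suff -> : (q j ^ G)%:R * (1 / (q j ^ G)%:R + 1 / (q j ^ G)%:R) = 2 :> R by [].
by field; rewrite gt_eqF ?qG_gt0.
Qed.

(** Rounding the box to level G costs 4 t in the count (four critical cells per coordinate, with at
    most one point each) and 2 t in the volume. [expanded_bound] compares the rounded quantities. *)
Lemma box_discrepancy :
  `|\sum_(n < N) xi n * (inbox n)%:R - V * \prod_j (b j - a j)|
    <= 6 * t%:R + (2 * (G.+1 * Q))%:R ^+ t * E.
Proof.
have inboxE n : (inbox n)%:R = \prod_j ((a j <= y j n) && (y j n < b j))%R%:R :> R.
  case: (boolP (inbox n)) => [/forallP h|]; first by rewrite big1 // => j _; rewrite h.
  rewrite negb_forall => /existsP[j /negPf nj].
  by rewrite (bigD1 j) //= nj mul0r.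
have count_err : `|\sum_(n < N) xi n * (inbox n)%:R - \sum_(n < N) xi n * \prod_j gj j n|
    <= 4 * t%:R.
  rewrite -sumrB; apply: le_trans (ler_norm_sum _ _ _) _.
  apply: (@le_trans _ _ (\sum_(n < N) \sum_j (near (c j G n) (b j) (q j ^ G) +
      near (c j G n) (a j) (q j ^ G)))).
    apply: ler_sum => n _; rewrite -mulrBr normrM inboxE.
    have /andP[xi0 xi1] := xi01 n; rewrite (ger0_norm xi0).
    apply: le_trans (ler_piMl _ xi1) _ => //.
    apply: le_trans (prod_dist _ _ _) _ => [j|j|]; last by apply: ler_sum => j _.
      by case: (_ && _); rewrite ?normr1 ?normr0.
    exact: gj_le1.
  rewrite exchange_big /= mulr_natr -[t in _ *+ t]card_ord -sumr_const.
  apply: ler_sum => j _; rewrite big_split /=.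
  by have := near_sum j (b j); have := near_sum j (a j); lra.
have vol_err : `|V * \prod_j vol j - V * \prod_j (b j - a j)| <= 2 * t%:R.
  rewrite -mulrBr normrM distrC mulr_natr -[t in _ *+ t]card_ord -sumr_const.
  apply: le_trans (ler_wpM2l (normr_ge0 V) (prod_dist _ _ _)) _.
  - by move=> j; have [/andP[h1 h2] h3] := ab j; rewrite ger0_norm; lra.
  - exact: vol_le1.
  by rewrite mulr_sumr; apply: ler_sum => j _; apply: vol_approx.
have -> : \sum_(n < N) xi n * (inbox n)%:R - V * \prod_j (b j - a j) =
  (\sum_(n < N) xi n * (inbox n)%:R - \sum_(n < N) xi n * \prod_j gj j n) +
  (V * \prod_j vol j - V * \prod_j (b j - a j)) +
  (\sum_(n < N) xi n * \prod_j gj j n - V * \prod_j vol j) by ring.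
apply: le_trans (ler_normD _ _) _; apply: lerD expanded_bound.
apply: le_trans (ler_normD _ _) _.
by move: count_err vol_err; lra.
Qed.

End BoxDiscrepancy.

Lemma sum_indicator_le1 (R : numDomainType) N (P : pred nat) :
  (forall m n, (m < N)%N -> (n < N)%N -> P m -> P n -> m = n) ->
  \sum_(n < N) (P n)%:R <= 1 :> R.
Proof.
move=> inj; rewrite -natr_sum (_ : (\sum_(n < N) P n)%N = #|[pred n : 'I_N | P n]|).
  rewrite (_ : 1 = 1%:R) // ler_nat; apply/card_le1_eqP => m n; rewrite !inE => Pm Pn.
  exact: val_inj (inj _ _ (ltn_ord n) (ltn_ord m) Pn Pm).
by rewrite -sum1_card [RHS]big_mkcond; apply: eq_bigr => n _; rewrite inE; case: (P n).
Qed.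

(** * The bound for the hybrid sequence with explicit constants *)

Section Hybrid.
Variables (R : archiRealFieldType) (p : nat) (pP : prime p).
Variables (l : nat -> 'F_p) (K : nat).
Hypothesis hkK : forall Q : {poly 'F_p},
  (forall k, (0 < k <= (size Q).-1 + K)%N -> hk l Q k = 0) -> Q = 0.
Variables (t : nat) (b : 'I_t -> {poly 'F_p}).
Hypothesis b_size : forall j, (1 < size (b j))%N.
Hypothesis b_coprime : forall i j, i != j -> coprimep (b i) (b j).
Variables (x : nat -> R) (y : 'I_t -> nat -> R).
Hypothesis x_digits : forall n s,
  (knum l (nX p n) s)%:R <= x n * (p ^ s)%:R <= (knum l (nX p n) s).+1%:R.
Let q j := (p ^ (size (b j)).-1)%N.
Hypothesis y_digits : forall j n g,
  (hnum (b j) (nX p n) g)%:R <= y j n * (q j ^ g)%:R <= (hnum (b j) (nX p n) g).+1%:R.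

Let p0 : (0 < p)%N := prime_gt0 pP.
Let q0 j : (0 < q j)%N. Proof. by rewrite expn_gt0 p0. Qed.

(** The difference of the two polynomials is divisible by b_j^M but has degree below M, so it is
    zero. *)
Lemma hnum_sep j M m n : (m < p ^ M)%N -> (n < p ^ M)%N ->
  hnum (b j) (nX p m) M = hnum (b j) (nX p n) M -> m = n.
Proof.
move=> mM nM /(hnum_inj pP (b_size j)) dvd.
suff /eqP : nX p m - nX p n = 0.
  by rewrite subr_eq0 => /eqP /(congr1 (@poly_at_p p)); rewrite !poly_at_p_nX.
apply/eqP; apply: contraLR dvd => D0; rewrite gtNdvdp //.
have b0 : b j != 0 by rewrite -size_poly_gt0 ltnW.
apply: leq_ltn_trans (size_polyD _ _) _; rewrite size_polyN gtn_max.
have szM : (M < size (b j ^+ M)%R)%N.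
  rewrite -[ltnRHS]prednK ?size_poly_gt0 ?expf_neq0 // size_exp ltnS.
  by rewrite leq_pmull // -ltnS prednK // ltnW.
by apply/andP; split; apply: leq_ltn_trans (size_nX pP _) szM.
Qed.

Lemma hybrid_bound N M Q (E a0 b0 : R) (a bb : 'I_t -> R) :
  0 <= a0 <= b0 -> b0 <= 1 -> (forall j, 0 <= a j <= bb j /\ bb j <= 1) ->
  (forall j, (q j <= Q)%N) -> (N < p ^ M)%N -> 0 <= E -> (p ^ (M + K))%:R <= E ^+ 2 ->
  `|\sum_(n < N) ((a0 <= x n) && (x n < b0))%R%:R *
        [forall j, (a j <= y j n) && (y j n < bb j)]%R%:R
     - N%:R * (b0 - a0) * \prod_j (bb j - a j)|
    <= 6 * t%:R + (2 * (M.+1 * Q))%:R ^+ t * ((M * p)%:R * (6 * E)).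
Proof.
move=> /andP[a0_ge a0b0] b01 ab qQ NM E0 hE.
(* The finest level is M: as N < p^M <= q_j^M, distinct indices below N lie in distinct cells. *)
apply: (@box_discrepancy R t q Q q0 qQ (fun j g n => hnum (b j) (nX p n) g) y
  (fun n => ((a0 <= x n) && (x n < b0))%R%:R) N M _ _ a bb) => //.
- by move=> j g n; apply: num_div; apply: poly_at_p_bdig.
- by move=> n; case: ((a0 <= x n) && _); rewrite ?lexx ?ler01.
- move=> j C; apply: (@sum_indicator_le1 R N (fun n => hnum (b j) (nX p n) M == C)).
  move=> m n mN nN /eqP Em /eqP En.
  by apply: (@hnum_sep j M); rewrite ?Em ?En // (ltn_trans _ NM).
- move=> j; apply: leq_trans (ltnW NM) _; rewrite -expnM leq_pexp2l //.
  by rewrite leq_pmull // -ltnS prednK // ltnW.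
- rewrite mulr_ge0 ?ler0n ?subr_ge0 //= ler_piMr ?ler0n //; lra.
(* [D] is the expected contribution of a single index; subtracting it termwise lets the error be
   summed block by block. *)
move=> g C hC; set D : R := (b0 - a0) / (\prod_j q j ^ g j)%:R.
pose f n : R := (hclass b g C n && ((a0 <= x n) && (x n < b0))%R)%:R - D.
rewrite (_ : _ - _ = \sum_(n < N) f n); last first.
  rewrite sumrB sumr_const card_ord -[D *+ N]mulr_natl /D mulrA; congr (_ - _).
  apply: eq_bigr => n _; rewrite mulrC -/(hclass b g C n).
  by case: hclass; rewrite /= ?mul1r ?mul0r.
apply: (block_sum p0 _ _ NM); first by rewrite mulr_ge0.
move=> u k kM; rewrite sumrB sumr_const card_ord -[D *+ _]mulr_natl.
apply: (block_error pP hkK b_size b_coprime x_digits u _ b01 hC E0); first by rewrite a0_ge.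
by apply: le_trans hE; rewrite ler_nat leq_pexp2l ?leq_add2r.
Qed.

End Hybrid.

(** * The real sequences *)

(** Applied with s = sqrt N, u = ln N and S s = E. The factor 4 Q comes from 2 (M + 1) <= 4 M, and
    4^(t + 1) from M <= 4 u. *)
Lemma collect_constants (R : realFieldType) (t M Q p : nat) (S s u : R) :
  0 <= S -> 1 <= s -> (0 < M)%N -> M%:R <= 4 * u ->
  6 * t%:R + (2 * (M.+1 * Q))%:R ^+ t * ((M * p)%:R * (6 * (S * s))) <=
  ((6 * t%:R + (4 * Q)%:R ^+ t * (p%:R * (6 * S))) * 4 ^+ t.+1 + 1) * s * u ^+ t.+1.
Proof.
move=> S0 s1 M0 Mu; set w := 6 * t%:R.
set C1 := (4 * Q)%:R ^+ t * _.
have w0 : 0 <= w by rewrite mulr_ge0.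
have M1 : 1 <= M%:R :> R by rewrite ler1n.
have u0 : 0 <= u by lra.
have s0 : 0 <= s by lra.
have C10 : 0 <= C1 by rewrite mulr_ge0 ?exprn_ge0 // !mulr_ge0.
have Mt1 : 1 <= M%:R ^+ t.+1 :> R by apply: exprn_ege1.
have Mt0 : 0 <= M%:R ^+ t.+1 :> R by apply: exprn_ge0.
have c0 : 0 <= w + C1 by rewrite addr_ge0.
apply: (@le_trans _ _ ((w + C1) * s * M%:R ^+ t.+1)).
  have -> : (w + C1) * s * M%:R ^+ t.+1 = w * s * M%:R ^+ t.+1 + C1 * s * M%:R ^+ t.+1.
    by ring.
  apply: lerD.
    by rewrite -mulrA ler_peMr // mulr_ege1.
  have -> : C1 * s * M%:R ^+ t.+1 =
      (M * (4 * Q))%:R ^+ t * ((M * p)%:R * (6 * (S * s))).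
    by rewrite /C1 exprS [(M * (4 * Q))%:R]natrM exprMn [(M * p)%:R]natrM; ring.
  apply: ler_wpM2r; first by rewrite !mulr_ge0.
  rewrite lerXn2r ?nnegrE ?ler0n // ler_nat.
  by rewrite mulnA [leqRHS]mulnA leq_mul2r; apply/orP; right; lia.
apply: (@le_trans _ _ ((w + C1) * s * (4 * u) ^+ t.+1)).
  by rewrite ler_wpM2l ?mulr_ge0 // lerXn2r ?nnegrE ?ler0n // mulr_ge0.
rewrite -subr_ge0 (_ : _ - _ = s * u ^+ t.+1) ?mulr_ge0 ?exprn_ge0 //.
by rewrite exprMn; ring.
Qed.

Section RealPoints.
Local Notation R := Rdefinitions.R.

Lemma infinite_sum_bounds (f : nat -> R) (v lo hi : R) s :
  infinite_sum f v ->
  (forall T, (s <= T)%N -> lo <= \sum_(i < T) f i <= hi) -> lo <= v <= hi.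
Proof.
move=> fv bounds.
have approx e : 0 < e -> exists2 w, lo <= w <= hi & `|w - v| < e.
  move=> /RltP e0; have [n0 n0P] := fv e e0.
  exists (\sum_(i < (maxn s n0).+1) f i).
    by apply: bounds; rewrite (leq_trans (leq_maxl s n0)).
  have /ssrnat.leP/n0P/RltP := leq_maxr s n0.
  by rewrite RdistE sum_f_R0E big_mkord.
apply/andP; split; rewrite leNgt; apply/negP => h.
  have [w /andP[lw _]] : exists2 w, lo <= w <= hi & `|w - v| < lo - v.
    by apply: approx; rewrite subr_gt0.
  by rewrite ltr_norml => /andP[_]; lra.
have [w /andP[_ wh]] : exists2 w, lo <= w <= hi & `|w - v| < v - hi.
  by apply: approx; rewrite subr_gt0.
by rewrite ltr_norml => /andP[]; lra.
Qed.

Lemma mul_bounds (S lo hi v : R) :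
  0 < S -> lo / S <= v <= hi / S -> lo <= v * S <= hi.
Proof. by move=> S0 /andP[]; rewrite ler_pdivrMr // ler_pdivlMr // => -> ->. Qed.

Lemma kron_point_bounds p (L : laurent p) n v s : prime p ->
  is_kron_point L n v ->
  (knum (fun k => lc L k%:Z) (nX p n) s)%:R <= v * (p ^ s)%:R <=
    (knum (fun k => lc L k%:Z) (nX p n) s).+1%:R.
Proof.
move=> pP vP; have p0 := prime_gt0 pP.
have S0 : 0 < (p ^ s)%:R :> R by rewrite ltr0n expn_gt0 p0.
apply: (mul_bounds S0); rewrite natrX.
apply: (infinite_sum_bounds (s := s) vP) => T sT.
have [|lo hi] := @sum_digits_bounds R p p0
  (fun i => nat_of_ord (hk (fun k => lc L k%:Z) (nX p n) i.+1)) s T _ sT.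
  by move=> i; apply: Fp_val_lt.
rewrite (eq_bigr (fun i : 'I_T =>
    (nat_of_ord (hk (fun k => lc L k%:Z) (nX p n) i.+1))%:R / p%:R ^+ i.+1)).
  by rewrite lo.
by move=> i _; rewrite kron_digitE !RealsE.
Qed.

Lemma vdc_bounds p (b : {poly 'F_p}) n g : prime p -> (1 < size b)%N ->
  (hnum b (nX p n) g)%:R <= vdc b n * ((p ^ (size b).-1) ^ g)%:R <=
    (hnum b (nX p n) g).+1%:R.
Proof.
move=> pP b1; set q := (p ^ _)%N.
have q0 : (0 < q)%N by rewrite expn_gt0 prime_gt0.
have S0 : 0 < (q ^ g)%:R :> R by rewrite ltr0n expn_gt0 q0.
apply: (mul_bounds S0); rewrite natrX.
pose d i := poly_at_p (bdig b (nX p n) i).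
have dT i : (n.+1 <= i)%N -> d i = 0%N.
  move=> ni; have bi : (i < size (b ^+ i)%R)%N.
    rewrite -[ltnRHS]prednK ?size_poly_gt0 ?expf_neq0 -?size_poly_gt0 ?(ltnW b1) //.
    by rewrite size_exp ltnS leq_pmull // -ltnS prednK // ltnW.
  rewrite /d /bdig divp_small ?mod0p ?/poly_at_p ?size_poly0 ?big_ord0 //.
  by apply: leq_ltn_trans bi; apply: leq_trans (size_poly _ _) ni.
(* The defining sum stops after n + 1 digits, while g may be larger; by [dT] it can be padded with
   zeros. *)
have -> : vdc b n = \sum_(i < n.+1 + g) (d i)%:R / q%:R ^+ i.+1.
  rewrite big_split_ord /= [X in _ + X]big1 => [|i _]; last first.
    by rewrite dT ?leq_addr // mul0r.
  rewrite addr0; apply: eq_bigr => i _.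
  by rewrite !RealsE /q natrX -exprM.
have [|lo hi] := @sum_digits_bounds R q q0 d g (n.+1 + g) _ (leq_addl _ _).
  by move=> i; apply: poly_at_p_bdig.
by rewrite lo.
Qed.

Lemma in_intvE (a b x : R) : in_intv a b x = (a <= x) && (x < b).
Proof.
rewrite /in_intv; case: Rle_dec => h1; last by rewrite (introF RleP h1).
by rewrite (introT RleP h1); case: Rlt_dec => h2; rewrite ?(introT RltP h2) ?(introF RltP h2).
Qed.

Lemma le_ln (u v : R) : 0 < u -> u <= v -> ln u <= ln v.
Proof.
move=> /RltP u0; rewrite le_eqVlt => /predU1P[->//|/RltP uv].
by apply/RleP/Rlt_le/ln_increasing.
Qed.

(** Since ln 2 > 1/2, both the logarithm to base p and the summand 1 are at most 2 ln N. *)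
Lemma trunc_log_le_ln p N : prime p -> (1 < N)%N ->
  (trunc_log p N).+1%:R <= 4 * ln (INR N).
Proof.
move=> pP N1; have p1 := prime_gt1 pP.
have ln_half m : (1 < m)%N -> 2^-1 < ln (INR m).
  move=> m1; have /RltP := ln_lt_2; rewrite RinvE => h.
  apply: lt_le_trans h _; apply: le_ln; first exact/RltP/Rlt_0_2.
  by rewrite !RealsE ler_nat.
have INR_p : 0 < INR p by rewrite INRE ltr0n prime_gt0.
have : ln (pow (INR p) (trunc_log p N)) <= ln (INR N).
  apply: le_ln; first by rewrite RpowE exprn_gt0.
  by rewrite !RealsE -natrX ler_nat trunc_logP // ltnW.
rewrite ln_pow; last exact/RltP.
rewrite RmultE INRE -natr1.
have := ln_half _ N1; have := ln_half _ p1.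
move: (ln (INR N)) (ln (INR p)) => lN lp h1 h2.
have : 0 <= (trunc_log p N)%:R :> R by [].
move: (_%:R) => m m0 h.
have : m * 2^-1 <= m * lp by rewrite ler_wpM2l // ltW.
lra.
Qed.

End RealPoints.

Theorem theorem2 (p : nat) (t : nat) (b : 'I_t -> {poly 'F_p})
  (L : laurent p) (A : nat -> {poly 'F_p}) (x : nat -> R) :
  prime p ->
  (forall j, b j \is monic) ->
  (forall j, (1 < size (b j))%N) ->
  (forall i j, i != j -> coprimep (b i) (b j)) ->
  lirrational L ->
  cf_expansion L A ->
  (exists K : nat, forall i, (1 <= i)%N -> ((size (A i)).-1 <= K)%N) ->
  (forall n, is_kron_point L n (x n)) ->
  exists c : R, Rlt 0 c /\
    forall (N : nat) (a0 b0 : R) (a bb : 'I_t -> R),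
      (2 <= N)%N -> is_box a0 b0 a bb ->
      Rle (Rabs (Rminus (INR (box_count x b N a0 b0 a bb))
                        (Rmult (INR N) (box_vol a0 b0 a bb))))
          (Rmult (Rmult c (sqrt (INR N))) (pow (ln (INR N)) (t + 1))).
Proof.
move=> pP _ b_size b_cop _ Lcf [K AK] xP.
have p0 := prime_gt0 pP.
pose Q := (\max_j p ^ (size (b j)).-1)%N.
(* Chosen so that p^(M + K) <= p^(K + 1) N = (S sqrt N)^2, where p^M is the least power of p
   exceeding N. *)
pose S := Num.sqrt (INR (p ^ K.+1)).
pose c := 6 * t%:R + (4 * Q)%:R ^+ t * (p%:R * (6 * S)).
(* Adding 1 turns c >= 0 into a positive constant. *)
pose c' := c * 4 ^+ t.+1 + 1.
have S_ge0 : 0 <= S by apply: sqrtr_ge0.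
have c_ge0 : 0 <= c by rewrite addr_ge0 // mulr_ge0 ?exprn_ge0 // !mulr_ge0.
exists c'; split.
  by apply/RltP; rewrite ltr_wpDl // mulr_ge0 // exprn_ge0.
move=> N a0 b0 a bb N2 [[/RleP a0_ge /RleP a0b0] [/RleP b01 abP]].
set M := (trunc_log p N).+1.
have NM : (N < p ^ M)%N by apply: trunc_log_ltn; apply: prime_gt1.
have MN : (p ^ M <= p * N)%N.
  by rewrite expnS leq_mul2l trunc_logP ?orbT ?prime_gt1 // ltnW.
have ln_M := trunc_log_le_ln pP N2; rewrite -/M in ln_M.
have sN1 : 1 <= Num.sqrt (INR N).
  by rewrite INRE -[leLHS]sqrtr1 ler_wsqrtr // ler1n ltnW.
pose E := S * Num.sqrt (INR N).
have hE : (p ^ (M + K))%:R <= E ^+ 2.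
  rewrite /E /S !INRE exprMn !sqr_sqrtr ?ler0n // -natrM ler_nat expnD expnSr mulnC -mulnA.
  by rewrite leq_mul2l MN orbT.
have E0 : 0 <= E by rewrite mulr_ge0 ?sqrtr_ge0.
have ab j : 0 <= a j <= bb j /\ bb j <= 1.
  by have [[/RleP h1 /RleP h2] /RleP h3] := abP j; rewrite h1 h2.
have qQ j : (p ^ (size (b j)).-1 <= Q)%N.
  exact: (leq_bigmax (F := fun j => (p ^ (size (b j)).-1)%N)).
have a0b0' : 0 <= a0 <= b0 by rewrite a0_ge.
have := hybrid_bound pP (hk_cf Lcf AK) b_size b_cop
  (fun n s => kron_point_bounds s pP (xP n))
  (fun j n g => vdc_bounds n g pP (b_size j)) a0b0' b01 ab qQ NM E0 hE.
move=> main; apply/RleP; rewrite !RealsE /box_vol.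
have countE : (box_count x b N a0 b0 a bb)%:R =
  \sum_(n < N) ((a0 <= x n) && (x n < b0))%R%:R *
        [forall j, (a j <= vdc (b j) n) && (vdc (b j) n < bb j)]%R%:R :> R.
  rewrite /box_count -sum1_count natr_sum big_mkcond /= -[N in iota _ N]subn0.
  rewrite -/(index_iota 0 N) big_mkord; apply: eq_bigr => n _.
  rewrite in_intvE; under eq_forallb do rewrite in_intvE.
  by rewrite -natrM mulnb; case: ifP.
rewrite countE mulrA.
apply: le_trans main _.
rewrite -INRE addn1; apply: collect_constants => //.
Qed.
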